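(* Let $K$ be a perfect ample field. Then $K$ has no existentially $K$-definable proper infinite subfields; that is, if $L$ is an infinite subfield of $K$ which, as a subset of $K$, is existentially $K$-definable, then $L = K$.
   Context: All varieties are geometrically irreducible and geometrically reduced; a curve is a variety of dimension $1$. A field $K$ is called ample (or large) if every smooth curve defined over $K$ with a $K$-rational point has infinitely many $K$-rational points. Formulas are first-order formulas in the language of rings. A subset $X \subseteq K$ is existentially $K$-definable if there is an existential formula $\varphi(x)$ in one free variable, with parameters from $K$, such that $X = \{x \in K : K \models \varphi(x)\}$. *)

(* Defs.v *)
From mathcomp Require Import all_boot all_order all_algebra all_field.
From mathcomp Require Import mpoly.

Set Implicit Arguments.
Unset Strict Implicit.
Unset Printing Implicit Defensive.

Import GRing.Theory.
Local Open Scope ring_scope.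

Definition perfect_field (K : fieldType) : Prop :=
  forall p : {poly K}, irreducible_poly p -> separable_poly p.

Definition subfield (K : fieldType) (L : K -> Prop) : Prop :=
  [/\ L 1,
      forall x y, L x -> L y -> L (x - y)
    & forall x y, L x -> L y -> L (x / y)].

Definition infinite_subset (T : eqType) (X : T -> Prop) : Prop :=
  forall s : seq T, exists2 x, X x & x \notin s.

(* A block of existential quantifiers in front of a quantifier-free formula;
   [GRing.rformula] excludes the symbols for the inverse and for units, which
   are not in the language of rings. *)
Fixpoint prenex_existential (K : fieldType) (f : GRing.formula K) : bool :=
  match f with
  | GRing.Exists _ g => prenex_existential g
  | _ => GRing.qf_form f
  end.

Definition existential_formula (K : fieldType) (f : GRing.formula K) : bool :=
  GRing.rformula f && prenex_existential f.

(* The free variable is ['X_0]. The parameters are the constants [c%:T] of [f];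
   under [GRing.holds [:: x]], any other free variable is read as the
   parameter 0. *)
Definition existentially_definable (K : fieldType) (X : K -> Prop) : Prop :=
  exists2 f : GRing.formula K,
    existential_formula f & forall x, X x <-> GRing.holds [:: x] f.

(* Every curve is quasi-projective, so that curves can be taken to be locally
   closed subschemes of a projective space P^n. *)

Section Ideals.
Variable R : comNzRingType.

Definition ideal_gen (E : R -> Prop) (x : R) : Prop :=
  exists s : seq (R * R),
    (forall u, u \in s -> E u.2) /\ x = \sum_(u <- s) u.1 * u.2.

Definition prime_ideal (P : R -> Prop) : Prop :=
  [/\ P 0, ~ P 1,
      forall x y, P x -> P y -> P (x + y),
      forall a x, P x -> P (a * x)
    & forall x y, P (x * y) -> P x \/ P y].

End Ideals.

Notation homogeneous p := (p \is ishomog mdeg).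

(* The open subscheme {g != 0 for some g in qp_neq} of the closed subscheme
   {f = 0 for all f in qp_eq} of P^n. *)
Record qproj (K : fieldType) (n : nat) := QProj {
  qp_eq : {mpoly K[n.+1]} -> Prop;
  qp_neq : {mpoly K[n.+1]} -> Prop;
  qp_eq_homog : forall f, qp_eq f -> homogeneous f;
  qp_neq_homog : forall g, qp_neq g -> homogeneous g
}.

Lemma map_mpoly_homog (K F : fieldType) (i : {rmorphism K -> F}) n
  (p : {mpoly K[n]}) : homogeneous p -> homogeneous (map_mpoly i p).
Proof.
case/homogP=> d /dhomogP hp; apply/homogP; exists d; apply/dhomogP=> m.
rewrite mcoeff_msupp mcoeff_map_mpoly fmorph_eq0 -mcoeff_msupp; exact: hp.
Qed.

Section BaseChange.
Variables (K F : fieldType) (i : {rmorphism K -> F}) (n : nat).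

Definition map_forms (E : {mpoly K[n.+1]} -> Prop) (q : {mpoly F[n.+1]}) :
  Prop := exists2 p, E p & q = map_mpoly i p.

Lemma map_forms_homog (E : {mpoly K[n.+1]} -> Prop) :
  (forall f, E f -> homogeneous f) ->
  forall q, map_forms E q -> homogeneous q.
Proof. by move=> hE q [p Ep ->]; apply/map_mpoly_homog/hE. Qed.

Definition base_change (X : qproj K n) : qproj F n :=
  QProj (map_forms_homog (@qp_eq_homog K n X))
        (map_forms_homog (@qp_neq_homog K n X)).

End BaseChange.

Section Schemes.
Variables (K : fieldType) (n : nat) (X : qproj K n).
Implicit Types (P : {mpoly K[n.+1]} -> Prop).

(* Scheme-theoretic points: the homogeneous primes of Proj K[x_0, ..., x_n]
   that lie on X. *)
Definition point P : Prop :=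
  [/\ prime_ideal P,
      forall p d, P p -> P (pihomog mdeg d p),
      exists j, ~ P 'X_j,
      forall f, qp_eq X f -> P f
    & exists2 g, qp_neq X g & ~ P g].

(* X is nonempty and any two nonempty basic open subsets of X meet. *)
Definition irreducible : Prop :=
  (exists P, point P) /\
  forall f g : {mpoly K[n.+1]}, homogeneous f -> homogeneous g ->
    (exists2 P, point P & ~ P f) -> (exists2 P, point P & ~ P g) ->
    exists2 P, point P & ~ P f /\ ~ P g.

(* Every local ring of X is reduced. At P, for a form h outside P of the same
   degree as f, (f / h)^k = 0 in the local ring if and only if s * f^k is in the
   ideal of X for some form s outside P. *)
Definition reduced : Prop :=
  forall P, point P ->
  forall (f s : {mpoly K[n.+1]}) (k : nat),
    homogeneous f -> homogeneous s -> ~ P s ->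
    ideal_gen (qp_eq X) (s * f ^+ k) ->
    exists t, [/\ homogeneous t, ~ P t & ideal_gen (qp_eq X) (t * f)].

(* Irreducible closed subsets correspond to points; larger primes give smaller
   closed subsets. *)
Definition has_chain (d : nat) : Prop :=
  exists P : nat -> {mpoly K[n.+1]} -> Prop,
    (forall i, (i <= d)%N -> point (P i)) /\
    (forall i, (i < d)%N ->
       (forall p, P i p -> P i.+1 p) /\ (exists2 p, P i.+1 p & ~ P i p)).

Definition has_dim (d : nat) : Prop := has_chain d /\ ~ has_chain d.+1.

(* [a] is a vector of homogeneous coordinates of a K-rational point of X. *)
Definition rational_point (a : 'rV[K]_n.+1) : Prop :=
  [/\ a != 0,
      forall f, qp_eq X f -> f.@[a ord0] = 0
    & exists2 g, qp_neq X g & g.@[a ord0] != 0].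

(* Homogeneous coordinates are taken up to a scalar factor. *)
Definition infinitely_many_rational_points : Prop :=
  forall s : seq 'rV[K]_n.+1,
    exists2 a, rational_point a & forall b, b \in s -> forall c, a != c *: b.

End Schemes.

Definition geometrically_irreducible (K : fieldType) n (X : qproj K n) : Prop :=
  forall (F : fieldType) (i : {rmorphism K -> F}), irreducible (base_change i X).

Definition geometrically_reduced (K : fieldType) n (X : qproj K n) : Prop :=
  forall (F : fieldType) (i : {rmorphism K -> F}), reduced (base_change i X).

Definition variety (K : fieldType) n (X : qproj K n) : Prop :=
  geometrically_irreducible X /\ geometrically_reduced X.

Definition curve (K : fieldType) n (X : qproj K n) : Prop :=
  variety X /\ has_dim X 1.

(* Jacobian criterion for smoothness of relative dimension d, at every point
   with coordinates in an extension field: n - d of the equations have linearly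
   independent gradients there. The (n+1)-variable Jacobian at a representative
   [a] has the same rank as the Jacobian in an affine chart around the point,
   by Euler's identity. *)
Definition smooth (K : fieldType) n (X : qproj K n) (d : nat) : Prop :=
  forall (F : fieldType) (i : {rmorphism K -> F}) (a : 'rV[F]_n.+1),
    rational_point (base_change i X) a ->
    exists (c : nat) (f : 'I_c -> {mpoly F[n.+1]}),
      [/\ (c + d)%N = n,
          forall j, qp_eq (base_change i X) (f j)
        & \rank (\matrix_(j < c, k < n.+1) ((f j)^`M(k)).@[a ord0]) = c].

Definition ample (K : fieldType) : Prop :=
  forall (n : nat) (X : qproj K n),
    curve X -> smooth X 1 ->
    (exists a, rational_point X a) -> infinitely_many_rational_points X.

(* Main.v *)
(* Let L be infinite, the projection of a quasi-affine set cut out over K. A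
   nonprincipal ultrafilter on L yields a generic point of that set; since K is
   perfect, after extracting p-th roots each of its coordinates is transcendental
   or separably algebraic over the preceding ones. Hence, around some K-point with
   first coordinate s0 (so that s0^q lies in L), Hensel's lemma gives a power
   series point of the set, etale over K[t], whose first coordinate is s0 + t.
   Given a = b^q in K, substitute t and b t: the two power series points together
   trace a smooth, geometrically integral curve with a K-point, so ampleness gives
   a K-point of it with t <> 0. Therefore (s0 + t)^q and (s0 + b t)^q lie in L, and
   ((s0 + b t)^q - s0^q) / ((s0 + t)^q - s0^q) = b^q = a. *)
Require Import Defs.
From mathcomp Require Import all_boot all_order all_algebra all_field.
From mathcomp Require Import boolp.
From mathcomp Require Import mpoly.
From mathcomp Require filter.
From HB Require Import structures.
From mathcomp Require Import ring.

Set Implicit Arguments.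
Unset Strict Implicit.
Unset Printing Implicit Defensive.

Import GRing.Theory.
Local Open Scope ring_scope.


(** * Iterated polynomial rings *)

(** Ampleness concerns only curves that stay integral over every field extension, which is hard to
    read off from equations. The usual order is therefore reversed: the curve is the closure of a
    power series point. Its ideal is the kernel of a map into a domain, and over an extension F it
    generates the ideal of the same series over F. The etale equations of the coordinates serve for
    the Jacobian, for the dimension and for the finiteness of the fibre over t = 0; the locus where
    the Jacobian degenerates is removed. Since that fibre is finite, ampleness yields a point with t
    <> 0. Inequations need not survive the passage to another point of the curve, so one polynomial
    G collects them, and its inverse is adjoined as a further coordinate. No ultrapower is built: a
    statement about the generic point is a statement that holds on a set of the ultrafilter. In
    characteristic 0 the exponent q is 1. *)

Fixpoint itpoly (K : idomainType) (k : nat) : idomainType :=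
  if k is k'.+1 then GRing.IntegralDomain.clone {poly itpoly K k'} _ else K.

Lemma itpoly_ind (K : idomainType) k (P : {poly itpoly K k} -> Prop) :
  P 0 -> (forall (f : {poly itpoly K k}) (c : itpoly K k), P f -> P (f * 'X + c%:P)) ->
  forall f, P f.
Proof. exact: poly_ind. Qed.

Section Evaluation.
Variables (K : idomainType) (R : comNzRingType) (iota : {rmorphism K -> R}).
Implicit Types (a b : nat -> R) (k : nat).

(** Iterated univariate rings keep the top variable as the variable of a [{poly _}], so that
    derivative, degree and pseudo-division in it are the univariate ones. Of the sequence of values
    only the first k terms are read. *)
Fixpoint ieval a k : {rmorphism itpoly K k -> R} :=
  match k with
  | 0 => iota
  | k'.+1 => horner_eval (a k') \o map_poly (ieval a k')
  end.

Lemma ievalS a k (f : {poly itpoly K k}) :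
  @ieval a k.+1 f = (map_poly (ieval a k) f).[a k].
Proof. by []. Qed.

Lemma eq_ieval a b k (f : itpoly K k) :
  (forall i, (i < k)%N -> a i = b i) -> ieval a k f = ieval b k f.
Proof.
elim: k f => [//|k IH] f eq_ab; rewrite !ievalS eq_ab //; congr (_.[_]).
by apply: eq_map_poly => c; apply: IH => i /ltnW; apply: eq_ab.
Qed.

Lemma ieval_const a k (c : itpoly K k) : @ieval a k.+1 c%:P = ieval a k c.
Proof. by rewrite ievalS map_polyC hornerC. Qed.

Lemma ievalX a k : @ieval a k.+1 'X = a k.
Proof. by rewrite ievalS map_polyX hornerX. Qed.

Lemma ievalMXaddC a k (f : {poly itpoly K k}) (c : itpoly K k) :
  @ieval a k.+1 (f * 'X + c%:P) = @ieval a k.+1 f * a k + ieval a k c.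
Proof. by rewrite !ievalS rmorphD rmorphM /= map_polyX map_polyC hornerMXaddC. Qed.

Lemma ievalMX a k (f : {poly itpoly K k}) :
  @ieval a k.+1 (f * 'X) = @ieval a k.+1 f * a k.
Proof. by rewrite !ievalS rmorphM /= map_polyX hornerMX. Qed.

Lemma deriv_ieval a k (f : {poly itpoly K k}) :
  (map_poly (ieval a k) f)^`() = map_poly (ieval a k) f^`().
Proof. by rewrite deriv_map. Qed.

End Evaluation.

Fixpoint iconst (K : idomainType) k : {rmorphism K -> itpoly K k} :=
  match k with
  | 0 => idfun
  | k'.+1 => polyC \o (iconst K k')
  end.

Lemma iconstS (K : idomainType) k c : iconst K k.+1 c = (iconst K k c)%:P.
Proof. by []. Qed.

Fixpoint ivar (K : idomainType) k (i : nat) : itpoly K k :=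
  match k with
  | 0 => 0
  | k'.+1 => if i == k' then 'X else (ivar K k' i)%:P
  end.

Lemma ivarS (K : idomainType) k i :
  ivar K k.+1 i = (if i == k then 'X else (ivar K k i)%:P).
Proof. by []. Qed.

Arguments ieval : simpl never.
Arguments iconst : simpl never.
Arguments ivar : simpl never.

Section IevalVar.
Variables (K : idomainType) (R : comNzRingType) (iota : {rmorphism K -> R}).

Lemma ieval_iconst (a : nat -> R) k c : ieval iota a k (iconst K k c) = iota c.
Proof. by elim: k => [//|k IH]; rewrite iconstS ieval_const. Qed.

Lemma ieval_ivar (a : nat -> R) k i : (i < k)%N -> ieval iota a k (ivar K k i) = a i.
Proof.
elim: k => [//|k IH]; rewrite ltnS leq_eqVlt ivarS; case: eqP => [-> _|_ lik].
  exact: ievalX.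
by rewrite ieval_const IH.
Qed.

Lemma rmorph_ieval (S : comNzRingType) (phi : {rmorphism R -> S})
    (kappa : {rmorphism K -> S}) (a : nat -> R) k (f : itpoly K k) :
  (forall c, phi (iota c) = kappa c) ->
  phi (ieval iota a k f) = ieval kappa (phi \o a) k f.
Proof.
move=> eq_c; elim: k f => [|k IH] f; first exact: eq_c.
rewrite !ievalS -horner_map /= -map_poly_comp; congr (_.[_]).
by apply: eq_map_poly => c /=; rewrite IH.
Qed.

End IevalVar.

(** * Formal power series and Hensel lifting *)

Record pser (K : fieldType) := Pser { pcoef : nat -> K }.

Section PserRing.
Variable K : fieldType.
Implicit Types (f g h : pser K) (p q : {poly K}).

HB.instance Definition _ := gen_eqMixin (pser K).
HB.instance Definition _ := gen_choiceMixin (pser K).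

Lemma pserP f g : (forall n, pcoef f n = pcoef g n) -> f = g.
Proof. by case: f g => [f] [g] /= /funext ->. Qed.

Definition pser_zero : pser K := Pser (fun=> 0).
Definition pser_opp f := Pser (fun n => - pcoef f n).
Definition pser_add f g := Pser (fun n => pcoef f n + pcoef g n).

Fact pser_addA : associative pser_add.
Proof. by move=> f g h; apply: pserP => n /=; rewrite addrA. Qed.
Fact pser_addC : commutative pser_add.
Proof. by move=> f g; apply: pserP => n /=; rewrite addrC. Qed.
Fact pser_add0 : left_id pser_zero pser_add.
Proof. by move=> f; apply: pserP => n /=; rewrite add0r. Qed.
Fact pser_addN : left_inverse pser_zero pser_opp pser_add.
Proof. by move=> f; apply: pserP => n /=; rewrite addNr. Qed.

HB.instance Definition _ :=
  GRing.isZmodule.Build (pser K) pser_addA pser_addC pser_add0 pser_addN.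

Definition pser_const (c : K) := Pser (fun n => if n == 0%N then c else 0).
Definition pser_mul f g :=
  Pser (fun n => \sum_(j < n.+1) pcoef f j * pcoef g (n - j)).

Definition ptrunc n f := \poly_(i < n.+1) pcoef f i.

(** The laws of the Cauchy product are inherited from [{poly K}]: coefficients up to n of a product
    depend only on the truncations of the factors. *)
Definition agree n f p := forall i, (i <= n)%N -> pcoef f i = p`_i.

Lemma agree_trunc n f : agree n f (ptrunc n f).
Proof. by move=> i lin; rewrite coef_poly ltnS lin. Qed.

Lemma agree_mul n f g p q :
  agree n f p -> agree n g q -> agree n (pser_mul f g) (p * q).
Proof.
move=> fp gq i lin /=; rewrite coefM; apply: eq_bigr => j _.
by rewrite fp ?gq // (leq_trans _ lin) ?leq_subr // -ltnS.
Qed.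

Fact pser_mulA : associative pser_mul.
Proof.
move=> f g h; apply: pserP => n.
have [[F G] H] := (@agree_trunc n f, @agree_trunc n g, @agree_trunc n h).
by rewrite (agree_mul F (agree_mul G H)) // (agree_mul (agree_mul F G) H) // mulrA.
Qed.
Fact pser_mulC : commutative pser_mul.
Proof.
move=> f g; apply: pserP => n; have [F G] := (@agree_trunc n f, @agree_trunc n g).
by rewrite (agree_mul F G) // (agree_mul G F) // mulrC.
Qed.
Fact agree_const n c : agree n (pser_const c) c%:P.
Proof. by move=> i _; rewrite coefC. Qed.
Fact pser_mul1 : left_id (pser_const 1) pser_mul.
Proof.
move=> f; apply: pserP => n; have F := @agree_trunc n f.
by rewrite (agree_mul (@agree_const n 1) F) // mul1r -F.
Qed.
Fact pser_mulDl : left_distributive pser_mul pser_add.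
Proof.
move=> f g h; apply: pserP => n /=; rewrite -big_split /=.
by apply: eq_bigr => j _; rewrite mulrDl.
Qed.
Fact pser_1neq0 : pser_const 1 != pser_zero.
Proof.
by apply/eqP => /(congr1 (fun f => pcoef f 0)) /eqP; rewrite /= oner_eq0.
Qed.

HB.instance Definition _ := GRing.Zmodule_isComNzRing.Build (pser K)
  pser_mulA pser_mulC pser_mul1 pser_mulDl pser_1neq0.

Lemma pcoef0 n : pcoef (0 : pser K) n = 0. Proof. by []. Qed.
Lemma pcoefD f g n : pcoef (f + g) n = pcoef f n + pcoef g n. Proof. by []. Qed.
Lemma pcoefN f n : pcoef (- f) n = - pcoef f n. Proof. by []. Qed.
Lemma pcoefB f g n : pcoef (f - g) n = pcoef f n - pcoef g n. Proof. by []. Qed.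
Lemma pcoefM f g n :
  pcoef (f * g) n = \sum_(j < n.+1) pcoef f j * pcoef g (n - j).
Proof. by []. Qed.

Lemma pcoefM0 f g : pcoef (f * g) 0 = pcoef f 0 * pcoef g 0.
Proof. by rewrite pcoefM big_ord1. Qed.

Definition vanishes_below n f := forall i, (i < n)%N -> pcoef f i = 0.

Lemma vanishes_belowM n m f g :
  vanishes_below n f -> vanishes_below m g -> vanishes_below (n + m) (f * g).
Proof.
move=> fn gm i lt_i; rewrite pcoefM big1 // => j _.
have [/fn -> | le_nj] := ltnP j n; first by rewrite mul0r.
have le_ji: (j <= i)%N by rewrite -ltnS.
rewrite gm ?mulr0 // ltn_subLR //; apply: leq_trans lt_i _.
by rewrite leq_add2r.
Qed.

Lemma pcoefM_vanishes n m f g : vanishes_below n f -> vanishes_below m g ->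
  pcoef (f * g) (n + m) = pcoef f n * pcoef g m.
Proof.
move=> fn gm; rewrite pcoefM (bigD1 (Ordinal (leq_addr m n : n < (n + m).+1)%N)) //=.
rewrite addKn big1 ?addr0 // => j ne_jn.
have [/fn -> | le_nj] := ltnP j n; first by rewrite mul0r.
have le_j: (j <= n + m)%N by rewrite -ltnS.
rewrite gm ?mulr0 // ltn_subLR // ltn_add2r ltn_neqAle le_nj andbT.
by apply: contraNneq ne_jn => eq_nj; apply/eqP/val_inj.
Qed.

Lemma pser_order f : f != 0 -> exists2 n, vanishes_below n f & pcoef f n != 0.
Proof.
move=> nz_f; have ex_n: exists n, pcoef f n != 0.
  apply: contrapT => no_n; case/eqP: nz_f; apply: pserP => n.
  by apply: contrapT => /eqP nz; case: no_n; exists n.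
case: (ex_minnP ex_n) => n nz_n min_n; exists n => // i lt_in.
by apply: contraTeq lt_in => /min_n; rewrite -leqNgt.
Qed.

(** The structure [idomainType] asks for a chosen inverse; classical choice supplies one without a
    recursion on coefficients. *)
Definition pser_unit f := `[< exists g, g * f = 1 >].
Definition pser_inv f :=
  if pselect (exists g, g * f = 1) is left e then projT1 (cid e) else f.

Fact pser_mulVf : {in pser_unit, left_inverse 1 pser_inv *%R}.
Proof.
move=> f /asboolP e; rewrite /pser_inv; case: pselect => // e'.
by case: (cid e').
Qed.
Fact pser_unitP f g : g * f = 1 -> pser_unit f.
Proof. by move=> e; apply/asboolP; exists g. Qed.
Fact pser_inv_out : {in [predC pser_unit], pser_inv =1 id}.
Proof. by move=> f /asboolP e; rewrite /pser_inv; case: pselect. Qed.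

HB.instance Definition _ := GRing.ComNzRing_hasMulInverse.Build (pser K)
  pser_mulVf pser_unitP pser_inv_out.

Fact pser_integral f g : f * g = 0 -> (f == 0) || (g == 0).
Proof.
move=> fg0; apply: contraT; rewrite negb_or => /andP[/pser_order[n fn nzf]].
case/pser_order=> m gm; apply: contraNT => _.
by have /eqP := pcoefM_vanishes fn gm; rewrite fg0 eq_sym mulf_eq0 (negPf nzf).
Qed.

HB.instance Definition _ :=
  GRing.ComUnitRing_isIntegral.Build (pser K) pser_integral.

Fact pser_const_zmod : zmod_morphism pser_const.
Proof. by move=> c d; apply: pserP => -[|n] //=; rewrite subr0. Qed.
Fact pser_const_monoid : monoid_morphism pser_const.
Proof.
split=> // c d; apply: pserP => -[|n]; first by rewrite pcoefM0.
by rewrite pcoefM big_ord_recl /= mulr0 add0r big1 // => j _; rewrite mul0r.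
Qed.
HB.instance Definition _ := GRing.isZmodMorphism.Build _ _ pser_const pser_const_zmod.
HB.instance Definition _ := GRing.isMonoidMorphism.Build _ _ pser_const pser_const_monoid.

Definition pser_eval0 f := pcoef f 0.
Fact pser_eval0_zmod : zmod_morphism pser_eval0. Proof. by []. Qed.
Fact pser_eval0_monoid : monoid_morphism pser_eval0.
Proof. by split=> // f g; rewrite /pser_eval0 pcoefM0. Qed.
HB.instance Definition _ := GRing.isZmodMorphism.Build _ _ pser_eval0 pser_eval0_zmod.
HB.instance Definition _ := GRing.isMonoidMorphism.Build _ _ pser_eval0 pser_eval0_monoid.

Lemma pcoef_constM c f n : pcoef (pser_const c * f) n = c * pcoef f n.
Proof.
rewrite pcoefM big_ord_recl subn0 big1 ?addr0 // => j _.
by rewrite /= mul0r.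
Qed.

Definition pserX := Pser (fun n => (n == 1%N)%:R : K).

(** The substitution t -> b t. It fixes constants and constant terms, also for b = 0. *)
Definition pser_subst (b : K) f := Pser (fun n => b ^+ n * pcoef f n).
Fact pser_subst_zmod b : zmod_morphism (pser_subst b).
Proof. by move=> f g; apply: pserP => n /=; rewrite mulrBr. Qed.
Fact pser_subst_monoid b : monoid_morphism (pser_subst b).
Proof.
split=> [|f g]; apply: pserP => n.
  by case: n => [|n] /=; rewrite ?mulr0 ?mulr1.
rewrite /= mulr_sumr; apply: eq_bigr => j _.
by rewrite mulrACA -exprD subnKC // -ltnS.
Qed.
HB.instance Definition _ b := GRing.isZmodMorphism.Build _ _ (pser_subst b) (pser_subst_zmod b).
HB.instance Definition _ b := GRing.isMonoidMorphism.Build _ _ (pser_subst b) (pser_subst_monoid b).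

Lemma pser_subst_const b c : pser_subst b (pser_const c) = pser_const c.
Proof. by apply: pserP => -[|n] /=; rewrite ?mulr0 ?mul1r. Qed.

Lemma pser_substX b : pser_subst b pserX = pser_const b * pserX.
Proof.
apply: pserP => n; rewrite pcoef_constM /=.
by case: eqP => [->|_]; rewrite ?mulr0 ?expr1.
Qed.

End PserRing.

Section PserMap.
Variables (K F : fieldType) (i : {rmorphism K -> F}).

Definition pser_map (f : pser K) := Pser (fun n => i (pcoef f n)).
Fact pser_map_zmod : zmod_morphism pser_map.
Proof. by move=> f g; apply: pserP => n /=; rewrite rmorphB. Qed.
Fact pser_map_monoid : monoid_morphism pser_map.
Proof.
split=> [|f g]; apply: pserP => n.
  by case: n => [|n] /=; rewrite ?rmorph0 ?rmorph1.
by rewrite /= rmorph_sum; apply: eq_bigr => j _; rewrite rmorphM.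
Qed.
HB.instance Definition _ := GRing.isZmodMorphism.Build _ _ pser_map pser_map_zmod.
HB.instance Definition _ := GRing.isMonoidMorphism.Build _ _ pser_map pser_map_monoid.

Lemma pser_map_const c : pser_map (pser_const c) = pser_const (i c).
Proof. by apply: pserP => -[|n] //=; rewrite rmorph0. Qed.

End PserMap.

Lemma horner_taylor2 (R : comNzRingType) (p : {poly R}) (x u : R) :
  exists r, p.[x + u] = p.[x] + p^`().[x] * u + u ^+ 2 * r.
Proof.
elim/poly_ind: p => [|p c [r IH]]; first by exists 0; rewrite deriv0 !horner0 mulr0 mul0r !addr0.
exists (r * (x + u) + p^`().[x]).
rewrite !(hornerMXaddC, hornerE, derivE) IH.
ring.
Qed.

Section Hensel.
Variables (K : fieldType) (H : {poly pser K}) (c : K).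
Hypotheses (H0 : pcoef H.[pser_const c] 0 = 0)
  (H'0 : pcoef H^`().[pser_const c] 0 != 0).

(** The correction is divided by the derivative at the starting point, not at the current iterate.
    Only a scalar of K has to be inverted, at the price of gaining a single coefficient per step. *)
Fixpoint newton_iter n : pser K :=
  if n is n'.+1 then
    newton_iter n' - pser_const (pcoef H^`().[pser_const c] 0)^-1 * H.[newton_iter n']
  else pser_const c.

Lemma newton_iterS n : newton_iter n.+1 =
  newton_iter n - pser_const (pcoef H^`().[pser_const c] 0)^-1 * H.[newton_iter n].
Proof. by []. Qed.

Lemma horner_pcoef0 (P : {poly pser K}) (z : pser K) :
  pcoef P.[z] 0 = pcoef P.[pser_const (pcoef z 0)] 0.
Proof.
rewrite -[LHS]/(@pser_eval0 K _) -[RHS]/(@pser_eval0 K _).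
by rewrite -!horner_map.
Qed.

Lemma newton_iterP n :
  pcoef (newton_iter n) 0 = c /\ vanishes_below n.+1 H.[newton_iter n].
Proof.
elim: n => [|n [IHc IHv]]; first by split=> // -[].
set z := newton_iter n in IHc IHv *; set d := pcoef H^`().[pser_const c] 0.
have vu: vanishes_below n.+1 (- (pser_const d^-1 * H.[z])).
  by move=> i lt_i; rewrite pcoefN pcoef_constM IHv // mulr0 oppr0.
split; first by rewrite newton_iterS -/z pcoefD vu // addr0.
move=> i; rewrite newton_iterS ltnS -/z -/d; set u := - _ in vu *.
have [r ->] := horner_taylor2 H z u.
have v2: vanishes_below n.+2 (u ^+ 2 * r).
  move=> j lt_j; apply: (@vanishes_belowM _ (n.+1 + n.+1) 0) => //.
    exact: vanishes_belowM.
  by rewrite addn0 (leq_trans lt_j) // addnS ltnS leq_addr.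
move=> le_i; rewrite pcoefD v2 // addr0 pcoefD.
have [lt_i|ge_i] := ltnP i n.+1.
  by rewrite IHv // add0r; apply: (@vanishes_belowM _ 0 n.+1).
(* Coefficient n + 1 is the only new one; there the linear term contributes d times - d^-1 times the
   coefficient of [H.[z]], and the two cancel. *)
have -> : i = (0 + n.+1)%N by apply/eqP; rewrite eqn_leq le_i.
rewrite pcoefM_vanishes // horner_pcoef0 IHc -/d pcoefN pcoef_constM.
by rewrite mulrN mulrA mulfV // mul1r subrr.
Qed.

Lemma newton_iter_stable n m i :
  (i <= n)%N -> (n <= m)%N -> pcoef (newton_iter m) i = pcoef (newton_iter n) i.
Proof.
move=> le_in /subnK <-; elim: (m - n)%N => [//|k IH].
rewrite addSn newton_iterS pcoefB pcoef_constM (newton_iterP _).2 ?mulr0 ?subr0 //.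
by rewrite ltnS (leq_trans le_in) ?leq_addl.
Qed.

Lemma hensel : exists2 z, pcoef z 0 = c & H.[z] = 0.
Proof.
(* Coefficient n no longer changes from step n on, so the diagonal is the limit of the iteration. *)
pose z := Pser (fun n => pcoef (newton_iter n) n); exists z => //.
apply: pserP => n; have [r] := horner_taylor2 H (newton_iter n) (z - newton_iter n).
rewrite addrC subrK => ->; rewrite -addrA expr2 -mulrA [_ * (z - _)]mulrC -mulrDr.
rewrite pcoefD (newton_iterP _).2 // add0r.
apply: (@vanishes_belowM _ n.+1 0) => [i|//|]; last by rewrite addn0.
by rewrite ltnS pcoefB /= => le_in; rewrite (newton_iter_stable _ le_in) ?subrr.
Qed.

End Hensel.

(** * The ideal of a power series point *)

Section IdealGen.
Variables (R : comNzRingType) (E : R -> Prop).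

Lemma ideal_gen0 : ideal_gen E 0.
Proof. by exists [::]; split=> //; rewrite big_nil. Qed.

Lemma ideal_genD x y : ideal_gen E x -> ideal_gen E y -> ideal_gen E (x + y).
Proof.
move=> [s [Es ->]] [t [Et ->]]; exists (s ++ t); rewrite big_cat; split=> // u.
by rewrite mem_cat => /orP[/Es|/Et].
Qed.

Lemma ideal_genM a x : E x -> ideal_gen E (a * x).
Proof.
by move=> Ex; exists [:: (a, x)]; rewrite big_seq1; split=> // u; rewrite inE => /eqP->.
Qed.

Lemma ideal_gen_sub (P : R -> Prop) x : prime_ideal P -> (forall y, E y -> P y) ->
  ideal_gen E x -> P x.
Proof.
case=> P0 _ PD PM _ EP [s [Es ->]]; rewrite big_seq.
by apply: big_ind => // u /Es/EP; apply: PM.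
Qed.

End IdealGen.

Lemma prime_idealX (R : comNzRingType) (P : R -> Prop) x k :
  prime_ideal P -> P (x ^+ k) -> P x.
Proof.
case=> _ P1 _ _ PP; elim: k => [/P1 //|k IH].
by rewrite exprS => /PP[//|/IH].
Qed.

Lemma prime_ideal_kernel (R : comNzRingType) (S : idomainType) (phi : {rmorphism R -> S}) :
  prime_ideal (fun x => phi x = 0).
Proof.
split=> [||x y|a x|x y]; rewrite ?rmorph0 ?rmorph1 ?rmorphD ?rmorphM //.
- by apply/eqP; rewrite oner_eq0.
- by move=> -> ->; rewrite addr0.
- by move=> ->; rewrite mulr0.
by move/eqP; rewrite mulf_eq0 => /orP[] /eqP; [left|right].
Qed.

Lemma mpoly_rmorph_ext (R : nzRingType) (S : comNzRingType) n
    (phi psi : {rmorphism {mpoly R[n]} -> S}) :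
  (forall c, phi c%:MP = psi c%:MP) -> (forall i, phi 'X_i = psi 'X_i) ->
  phi =1 psi.
Proof.
move=> eqC eqX p; rewrite (mpolyE p) !rmorph_sum; apply: eq_bigr => m _.
rewrite -mul_mpolyC !rmorphM eqC mpolyXE_id !rmorph_prod; congr (_ * _).
by apply: eq_bigr => i _; rewrite !rmorphXn eqX.
Qed.

Lemma mcoeff_pihomog (R : nzRingType) n d (p : {mpoly R[n]}) m :
  (pihomog mdeg d p)@_m = if mdeg m == d then p@_m else 0.
Proof.
case: ifP => [/eqP <-|/negbT ne]; last first.
  by apply: (dhomog_nemf_coeff (pihomogP _ d p)).
rewrite {2}(@pihomog_partitionE _ _ mdeg (maxn (msize p) (mdeg m).+1) p) ?leq_maxl //.
rewrite [in RHS]raddf_sum (bigD1 (Ordinal (leq_maxr (msize p) (mdeg m).+1))) //=.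
rewrite big1 ?addr0 // => k ne_k.
apply: (dhomog_nemf_coeff (pihomogP _ k p)); rewrite eq_sym.
by apply: contraNneq ne_k => eq_k; apply/eqP/val_inj.
Qed.

Lemma pihomog_map_mpoly (K F : fieldType) (i : {rmorphism K -> F}) n d
    (p : {mpoly K[n]}) :
  pihomog mdeg d (map_mpoly i p) = map_mpoly i (pihomog mdeg d p).
Proof.
apply/mpolyP => m; rewrite !(mcoeff_pihomog, mcoeff_map_mpoly).
by case: ifP => _ //; rewrite raddf0.
Qed.

Section HomogeneousPoint.
Variables (R : nzRingType) (n : nat).

(** Homogeneous coordinates (1 : e_0 : ... : e_n). Index 0 is the homogenizing coordinate, so ['X_k]
    with k > 0 carries [e k.-1]. *)
Definition hpoint (e : nat -> R) (k : 'I_n.+2) : R :=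
  if (k == 0 :> nat)%N then 1 else e k.-1.

End HomogeneousPoint.

Section CurveIdeal.
Variables (K : fieldType) (n : nat) (e : nat -> pser K).
Implicit Types p q : {mpoly K[n.+2]}.

Definition evp p : pser K := mmap (@pser_const K) (hpoint e) p.
HB.instance Definition _ := GRing.RMorphism.copy evp
  (mmap (@pser_const K) (@hpoint _ n e)).

Lemma evpC c : evp c%:MP = pser_const c. Proof. exact: mmapC. Qed.
Lemma evpX i : evp 'X_i = hpoint e i.
Proof. by rewrite /evp mmapX mmap1U. Qed.

Lemma evpM p q : evp (p * q) = evp p * evp q. Proof. exact: rmorphM. Qed.

(** Evaluation at (T, e_0 T, ..., e_n T). The new variable T separates degrees, which exhibits the
    homogeneous ideal of the point as the kernel of a ring morphism into the domain K[[t]][T]. *)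
Definition evT p : {poly pser K} :=
  mmap (polyC \o @pser_const K) (fun k => (hpoint e k)%:P * 'X) p.
HB.instance Definition _ := GRing.RMorphism.copy evT
  (mmap (polyC \o @pser_const K) (fun k => (@hpoint _ n e k)%:P * 'X)).

Lemma coef_evT p d : (evT p)`_d = evp (pihomog mdeg d p).
Proof.
rewrite {1}(mpolyE p) rmorph_sum coef_sum pihomogE rmorph_sum /= [RHS]big_mkcond /=.
apply: eq_bigr => m _.
rewrite /evT mmapZ mmapX /mmap1 /=.
under eq_bigr do rewrite exprMn -rmorphXn /=.
rewrite big_split /= -rmorph_prod prodrXr -mdegE mulrA -rmorphM coefCM coefXn.
rewrite eq_sym; case: eqP => _; last by rewrite mulr0.
by rewrite mulr1 /evp mmapZ mmapX.
Qed.

(** The homogeneous ideal of the Zariski closure of the power series point. *)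
Definition curve_ideal p := forall d, evp (pihomog mdeg d p) = 0.

Lemma curve_idealE p : curve_ideal p <-> evT p = 0.
Proof.
split=> [pI|pI d]; first by apply/polyP => d; rewrite coef_evT pI coef0.
by rewrite -coef_evT pI coef0.
Qed.

Lemma curve_ideal_prime : prime_ideal curve_ideal.
Proof.
have := prime_ideal_kernel evT.
by congr prime_ideal; apply/funext => p; apply/propext; rewrite curve_idealE.
Qed.

(** The disjunction covers both forms of known degree d and forms of unspecified degree; in the
    latter case d is a dummy argument. *)
Lemma curve_ideal_homog d p : homogeneous p || (p \is d.-homog) ->
  curve_ideal p <-> evp p = 0.
Proof.
have hom e' : p \is e'.-homog -> curve_ideal p <-> evp p = 0.
  move=> hp; split=> [/(_ e')|p0 d']; first by rewrite pihomog_dE.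
  have [->|ne] := eqVneq d' e'; first by rewrite pihomog_dE.
  by rewrite (pihomog_ne0 _ hp) ?rmorph0 // eq_sym.
by case/orP => [/homogP[e']|]; apply: hom.
Qed.

Lemma curve_ideal_pihomog p d : curve_ideal p -> curve_ideal (pihomog mdeg d p).
Proof.
by move=> pI; apply/(@curve_ideal_homog d); rewrite ?pihomogP ?orbT.
Qed.

Lemma curve_ideal_X0 : ~ curve_ideal 'X_ord0.
Proof.
have hX : ('X_ord0 : {mpoly K[n.+2]}) \is 1%N.-homog by rewrite dhomogX /= mdeg1.
move/(@curve_ideal_homog 1%N); rewrite hX orbT => /(_ isT).
by rewrite evpX => /eqP; rewrite oner_eq0.
Qed.

Definition curve_forms p := homogeneous p /\ curve_ideal p.

Lemma curve_forms_gen p : curve_ideal p ->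
  exists s, (forall q, q \in s -> curve_forms q) /\ p = \sum_(q <- s) q.
Proof.
move=> pI; exists [seq pihomog mdeg d p | d <- index_iota 0 (msize p)]; split.
  move=> _ /mapP[d _ ->]; split; last exact: curve_ideal_pihomog.
  by apply/homogP; exists d; apply: pihomogP.
rewrite big_map big_mkord.
exact: pihomog_partitionE.
Qed.

Variables (g : {mpoly K[n.+2]}) (gh : homogeneous g).

Lemma curve_forms_homog p : curve_forms p -> homogeneous p. Proof. by case. Qed.
Lemma eq_homog p : p = g -> homogeneous p. Proof. by move->. Qed.

(** The equations are restricted to forms because [qproj] admits only these; by [curve_forms_gen]
    they generate the whole ideal. The form g will be chosen so that its complement is smooth. *)
Definition pser_curve : qproj K n.+1 := QProj curve_forms_homog eq_homog.

End CurveIdeal.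

(** * Base change of the ideal of a power series point *)

Section BaseChangeCurve.
Variables (K F : fieldType) (i : {rmorphism K -> F}) (n : nat) (e : nat -> pser K).
Let eF k := pser_map i (e k).

Lemma evp_map (p : {mpoly K[n.+2]}) :
  evp eF (map_mpoly i p) = pser_map i (evp e p).
Proof.
apply: (mpoly_rmorph_ext (phi := evp eF \o map_mpoly i)
  (psi := pser_map i \o evp e)) => [c|j] /=.
  by rewrite map_mpolyC !evpC pser_map_const.
rewrite map_mpolyX !evpX /hpoint; case: eqP => // _.
by rewrite rmorph1.
Qed.

Lemma curve_ideal_map (p : {mpoly K[n.+2]}) :
  curve_ideal e p -> curve_ideal eF (map_mpoly i p).
Proof. by move=> pI d; rewrite pihomog_map_mpoly evp_map pI rmorph0. Qed.

Let combination (s : seq (F * {mpoly K[n.+2]})) :=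
  \sum_(u <- s) u.1 *: map_mpoly i u.2.

(* A combination with r terms that lies in the ideal over F either has all its
   terms in the ideal over K, or some K-linear functional (a coefficient of the
   power series) yields an F-linear relation that removes one term. *)
Lemma curve_ideal_descent s : curve_ideal eF (combination s) ->
  ideal_gen (map_forms i (curve_forms e)) (combination s).
Proof.
have [r] := ubnP (size s); elim: r s => // r IH s; rewrite ltnS => le_s sI.
have [all_I|] := pselect (forall u, u \in s -> curve_ideal e u.2).
  rewrite /combination big_seq; apply: big_ind => [||u /all_I uI].
  - exact: ideal_gen0.
  - exact: ideal_genD.
  have [t [tI ->]] := curve_forms_gen uI.
  rewrite rmorph_sum scaler_sumr big_seq; apply: big_ind => [||q /tI qI].
  - exact: ideal_gen0.
  - exact: ideal_genD.
  by rewrite -mul_mpolyC; apply: ideal_genM; exists q.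
move=> /existsNP[u /not_implyP[us /existsNP[d uI]]].
have [k uk] : exists k, pcoef (evp e (pihomog mdeg d u.2)) k != 0.
  apply: contrapT => nex; apply: uI; apply: pserP => k.
  by apply: contrapT => /eqP nz; apply: nex; exists k.
pose lam (p : {mpoly K[n.+2]}) := pcoef (evp e (pihomog mdeg d p)) k.
have lamE : \sum_(v <- s) v.1 * i (lam v.2) = 0.
  rewrite -[RHS](pcoef0 F k) -(sI d).
  rewrite /combination (raddf_sum (pihomog mdeg d)) rmorph_sum /=.
  rewrite (big_morph (fun f : pser F => pcoef f k) (id1 := 0) (op1 := +%R)) //.
  apply: eq_bigr => v _; rewrite linearZ /= -mul_mpolyC evpM evpC.
  by rewrite pcoef_constM pihomog_map_mpoly evp_map.
have /perm_to_rem ps := us; set s' := rem u s in ps.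
pose f (v : F * {mpoly K[n.+2]}) := (v.1, v.2 - (lam v.2 / lam u.2) *: u.2).
have sE : combination s = combination (map f s').
  rewrite /combination big_map (perm_big _ ps) big_cons.
  move: lamE; rewrite (perm_big _ ps) big_cons => /eqP; rewrite addr_eq0 => /eqP lamE.
  have iu : i (lam u.2) != 0 by rewrite fmorph_eq0.
  have -> : u.1 = - \sum_(v <- s') v.1 * i (lam v.2 / lam u.2).
    apply: (mulIf iu); rewrite lamE mulNr mulr_suml; congr (- _).
    by apply: eq_bigr => v _; rewrite -mulrA -rmorphM divfK.
  rewrite scaleNr scaler_suml -sumrN /= -big_split; apply: eq_bigr => v _ /=.
  by rewrite rmorphB /= map_mpolyZ scalerBr scalerA addrC.
rewrite sE in sI *; apply: IH => //.
rewrite size_map /s' size_rem //.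
by case: (s) us le_s.
Qed.

(** The source of geometric integrality: the extended ideal is again the kernel of a map into a
    domain, F[[t]][T], and so remains prime. *)
Lemma curve_ideal_base_change (q : {mpoly F[n.+2]}) :
  curve_ideal eF q <-> ideal_gen (map_forms i (curve_forms e)) q.
Proof.
split; last first.
  apply: ideal_gen_sub; first exact: curve_ideal_prime.
  by move=> _ [p [_ pI] ->]; apply: curve_ideal_map.
suff -> : q = combination [seq (q@_m, 'X_[m]) | m <- msupp q].
  exact: curve_ideal_descent.
rewrite /combination big_map {1}(mpolyE q); apply: eq_bigr => m _ /=.
by rewrite map_mpolyX.
Qed.

End BaseChangeCurve.

(** * Geometric irreducibility and reducedness *)

Section CurveVariety.
Variables (K : fieldType) (n : nat) (e : nat -> pser K).
Variables (g : {mpoly K[n.+2]}) (gh : homogeneous g).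
Hypothesis (g_neq0 : evp e g != 0).
Let X := pser_curve e gh.

Lemma generic_point (F : fieldType) (i : {rmorphism K -> F}) :
  point (base_change i X) (curve_ideal (pser_map i \o e)).
Proof.
split.
- exact: curve_ideal_prime.
- by move=> p d; apply: curve_ideal_pihomog.
- by exists ord0; apply: curve_ideal_X0.
- by move=> _ [p [_ pI] ->]; apply: curve_ideal_map.
exists (map_mpoly i g); first by exists g.
move/(@curve_ideal_homog _ _ _ 0); rewrite map_mpoly_homog // => /(_ isT).
move/eqP; rewrite evp_map; apply/negP; apply: contraNneq g_neq0 => g0.
apply/eqP/pserP => k; apply: (fmorph_inj i); rewrite [RHS]rmorph0.
by rewrite -[LHS]/(pcoef (pser_map i (evp e g)) k) g0.
Qed.

Lemma curve_ideal_sub_point (F : fieldType) (i : {rmorphism K -> F}) P q :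
  point (base_change i X) P -> curve_ideal (pser_map i \o e) q -> P q.
Proof.
by case=> Pp _ _ PE _ /curve_ideal_base_change; apply: ideal_gen_sub.
Qed.

(** Every point of the base change contains the ideal of the generic point. Hence the generic point
    lies in each nonempty open subset, and reducedness follows because that ideal is prime. *)
Lemma pser_curve_variety : variety X.
Proof.
split=> F i.
  split; first by exists (curve_ideal (pser_map i \o e)); apply: generic_point.
  move=> p q _ _ [P PX Pp] [Q QX Qq]; exists (curve_ideal (pser_map i \o e)).
    exact: generic_point.
  by split=> /curve_ideal_sub_point; [move/(_ _ PX)|move/(_ _ QX)].
move=> P PX f s k _ _ nPs /curve_ideal_base_change skI.
have [Cp _ _ _ _] := @generic_point F i.
(* Primality removes both s and the exponent k without any localization, so the form 1 serves as
   t. *)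
exists 1; split.
- by apply/homogP; exists 0%N; apply: dhomog1.
- by case: PX => -[].
rewrite mul1r; apply/curve_ideal_base_change/(prime_idealX (k := k) Cp).
case: (Cp) => _ _ _ _ /(_ _ _ skI)[/(curve_ideal_sub_point PX)//|//].
Qed.

End CurveVariety.

(** * Algebraic dependence modulo primes *)

Section Dependence.
Variables (K : fieldType) (S : comNzRingType) (iota : {rmorphism K -> S}).

(** For a prime P this says that the residue ring S/P has transcendence degree less than k over K;
    it is the substitute for Krull dimension. *)
Definition dependent_mod k (P : S -> Prop) :=
  forall a : nat -> S, exists2 R : itpoly K k, R != 0 & P (ieval iota a k R).

(** Append q as the last coordinate and take a relation modulo P. Powers of q can be cancelled since
    q is not in P, so the constant term c in the last variable may be taken nonzero; modulo Q, where
    q vanishes, c is a relation among the others. *)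
Lemma dependent_mod_drop k (P Q : S -> Prop) q :
    prime_ideal P -> prime_ideal Q -> (forall x, P x -> Q x) -> Q q -> ~ P q ->
  dependent_mod k.+1 P -> dependent_mod k Q.
Proof.
move=> Pp Qp PQ Qq nPq depP a; case: (depP (fun j => if j == k then q else a j)) => R.
rewrite ievalS eqxx.
have -> : map_poly (ieval iota (fun j => if j == k then q else a j) k) R =
          map_poly (ieval iota a k) R.
  by apply: eq_map_poly => c; apply: eq_ieval => j; case: eqP => // ->; rewrite ltnn.
elim/poly_ind: R => [|R c IH]; first by rewrite eqxx.
rewrite rmorphD rmorphM /= map_polyX map_polyC hornerMXaddC /=.
have [->|nz_c] := eqVneq c 0 => nzR RP.
  apply: IH; first by apply: contraNneq nzR => ->; rewrite mul0r addr0.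
  move: RP; rewrite rmorph0 addr0; case: Pp => _ _ _ _ PP /PP[//|/nPq //].
exists c => //; case: (Qp) => _ _ QD QM _.
set r := _ * q in RP; rewrite -[ieval _ _ _ _](addKr r); apply: QD; last exact: PQ.
by rewrite /r -mulNr; apply: QM.
Qed.

End Dependence.

Section BoxPolynomials.
Variables (K : fieldType) (b : nat).

(** The monomials with all exponents below b are numbered by m < b^k: the exponent of variable i is
    the i-th digit of m in base b. *)
Fixpoint box_poly k : (nat -> K) -> itpoly K k :=
  match k with
  | 0 => fun c => c 0%N
  | k'.+1 => fun c => \poly_(d < b) box_poly k' (fun m => c (d * b ^ k' + m)%N)
  end.

Lemma box_poly_eq0 k c : box_poly k c = 0 -> forall m, (m < b ^ k)%N -> c m = 0.
Proof.
elim: k c => [c c0 m|k IH c c0 m lt_m]; first by rewrite expn0 ltnS leqn0 => /eqP->.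
have bk_gt0 : (0 < b ^ k)%N.
  by rewrite expn_gt0; case: (b) lt_m => //; rewrite exp0n.
have lt_d : (m %/ b ^ k < b)%N by rewrite ltn_divLR // -expnS.
have := congr1 (fun p : {poly itpoly K k} => p`_(m %/ b ^ k)) c0.
rewrite /= coef_poly lt_d coef0 => /IH/(_ (m %% b ^ k)%N).
by rewrite -divn_eq; apply; rewrite ltn_pmod.
Qed.

Variables (S : comNzRingType) (iota : {rmorphism K -> S}) (a : nat -> S).

Fixpoint box_monomial k (m : nat) : S :=
  if k is k'.+1 then box_monomial k' (m %% b ^ k') * a k' ^+ (m %/ b ^ k') else 1.

Lemma big_nat_mul_blocks (F : nat -> S) d c :
  \sum_(0 <= m < d * c) F m = \sum_(0 <= j < d) \sum_(0 <= m < c) F (j * c + m)%N.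
Proof.
elim: d => [|d IH]; first by rewrite mul0n !big_geq.
rewrite big_nat_recr //= -IH mulSn addnC (big_cat_nat (n := (d * c)%N)) ?leq_addr //=.
by congr (_ + _); rewrite -{1}[(d * c)%N]add0n big_addn addKn; apply: eq_bigr => m _; rewrite addnC.
Qed.

Lemma ieval_box_poly k c :
  ieval iota a k (box_poly k c) = \sum_(0 <= m < b ^ k) iota (c m) * box_monomial k m.
Proof.
elim: k c => [|k IH] c; first by rewrite expn0 big_nat1 mulr1.
have [b0|b_gt0] := posnP b.
  rewrite b0 exp0n // big_geq // ievalS /= b0.
  rewrite (_ : \poly_(d < 0) _ = 0) ?rmorph0 ?horner0 //.
  by apply/polyP => j; rewrite coef_poly coef0.
rewrite ievalS expnS big_nat_mul_blocks /= poly_def rmorph_sum horner_sum big_mkord.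
apply: eq_bigr => d _; rewrite -mul_polyC rmorphM /= map_polyC map_polyXn hornerCM hornerXn /=.
rewrite IH mulr_suml; apply: eq_big_nat => m /= lt_m.
by rewrite modnMDl modn_small // divnMDl ?divn_small ?addn0 ?mulrA // (leq_trans _ lt_m).
Qed.

End BoxPolynomials.

(** A crude count, by inclusion in a box; only the exponent N matters for the comparison with
    b^(N+1). *)
Lemma card_bmultinom_le N D : (#|{: 'X_{1..N < D.+1}}| <= D.+1 ^ N)%N.
Proof.
have lt_m (m : 'X_{1..N < D.+1}) i : (m i < D.+1)%N.
  apply: leq_ltn_trans (bmdeg m); rewrite mdegE (bigD1 i) //=; exact: leq_addr.
pose f (m : 'X_{1..N < D.+1}) := [ffun i : 'I_N => inord (m i) : 'I_D.+1].
have -> : (D.+1 ^ N = #|{: {ffun 'I_N -> 'I_D.+1}}|)%N by rewrite card_ffun !card_ord.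
apply: (@leq_card _ _ f).
move=> m m' /ffunP eq_f; apply/val_inj/mnmP => i.
by have := congr1 val (eq_f i); rewrite !ffunE /= !inordK.
Qed.

Section MpolyDependence.
Variables (K : fieldType) (N : nat).

Lemma msizeM_leS (p q : {mpoly K[N]}) i j :
  (msize p <= i.+1)%N -> (msize q <= j.+1)%N -> (msize (p * q) <= (i + j).+1)%N.
Proof.
move=> le_p le_q; have [->|nz_p] := eqVneq p 0; first by rewrite mul0r msize0.
have [->|nz_q] := eqVneq q 0; first by rewrite mulr0 msize0.
rewrite msizeM // -subn1 leq_subLR add1n.
by apply: leq_trans (leq_add le_p le_q) _; rewrite addSn addnS.
Qed.

Lemma msize_exp_le (p : {mpoly K[N]}) s d :
  (msize p <= s.+1)%N -> (msize (p ^+ d) <= (d * s).+1)%N.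
Proof.
move=> sp; elim: d => [|d IH]; first by rewrite expr0 msize1.
by rewrite exprS mulSn; apply: msizeM_leS.
Qed.

Lemma msize_box_monomial (a : nat -> {mpoly K[N]}) b s k m :
    (forall j, (j < k)%N -> (msize (a j) <= s.+1)%N) -> (m < b ^ k)%N ->
  (msize (box_monomial b a k m) <= (k * (b * s)).+1)%N.
Proof.
elim: k m => [|k IH] m le_a lt_m /=; first by rewrite msize1.
have bk_gt0 : (0 < b ^ k)%N.
  by rewrite expn_gt0; case: (b) lt_m => //; rewrite exp0n.
have IHm := IH (m %% b ^ k)%N (fun j lt_j => le_a j (ltnW lt_j)) (ltn_pmod m bk_gt0).
have le_d : (m %/ b ^ k * s <= b * s)%N.
  by rewrite leq_mul2r ltnW ?orbT // ltn_divLR // -expnS.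
have IHd := msize_exp_le (m %/ b ^ k) (le_a k (ltnSn k)).
apply: leq_trans (msizeM_leS IHm IHd) _.
by rewrite ltnS mulSn addnC leq_add2r.
Qed.

#[local] Arguments box_monomial : simpl never.

(* Counting: the b^(N+1) box monomials in N+1 elements have degree O(b), hence
   lie in a space of dimension O(b^N). *)
Lemma mpoly_dependent :
  dependent_mod (@mpolyC N K) N.+1 (fun p => p = 0).
Proof.
move=> a; pose s := \max_(j < N.+1) msize (a j).
have le_a j : (j < N.+1)%N -> (msize (a j) <= s.+1)%N.
  by move=> lt_j; apply/leqW/(leq_bigmax (Ordinal lt_j)).
(* The box monomials have degree at most D = (N+1) b s, and D + 1 <= b C. There are then at most (b
   C)^N multi-indices, fewer than b^(N+1) as soon as b > C^N. *)
pose C := (N.+1 * s).+1; pose b := (C ^ N).+1.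
pose D := (N.+1 * (b * s))%N; pose M := #|{: 'X_{1..N < D.+1}}|.
have lt_M : (M < b ^ N.+1)%N.
  apply: leq_ltn_trans (card_bmultinom_le N D) _.
  have le_D : (D.+1 <= b * C)%N by rewrite /D /C mulnS mulnCA -addn1 addnC leq_add2r.
  have le_DN : (D.+1 ^ N <= (b * C) ^ N)%N by case: (N) => // N'; rewrite leq_exp2r.
  apply: leq_ltn_trans le_DN _.
  by rewrite expnMn expnS mulnC ltn_pmul2r ?expn_gt0.
pose A := \matrix_(m < b ^ N.+1, j < M) (box_monomial b a N.+1 m)@_(enum_val j).
(* A has more rows than columns; a nonzero row vector that kills it lists the coefficients of the
   relation. *)
have : kermx A != 0.
  rewrite kermx_eq0; apply: contraTneq lt_M => rA; rewrite -leqNgt -{1}rA.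
  exact: rank_leq_col.
case/rowV0Pn => v /sub_kermxP vA nz_v.
pose c m := if insub m is Some i then v 0 i else 0.
have cE (m : 'I_(b ^ N.+1)) : c m = v 0 m by rewrite /c valK.
exists (box_poly b N.+1 c).
  apply: contraNneq nz_v => /box_poly_eq0 c0; apply/eqP/rowP => m.
  by rewrite mxE -cE c0.
rewrite ieval_box_poly big_mkord; apply/mpolyP => m; rewrite mcoeff0 raddf_sum /=.
have [lt_m|ge_m] := ltnP (mdeg m) D.+1; last first.
  apply: big1 => j _; rewrite mcoeffCM memN_msupp_eq0 ?mulr0 //.
  by apply: msize_mdeg_ge; apply: leq_trans ge_m; apply: msize_box_monomial.
have := congr1 (fun B : 'rV_M => B 0 (enum_rank (BMultinom lt_m))) vA.
rewrite !mxE => eq0; rewrite -[RHS]eq0; apply: eq_bigr => j _.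
by rewrite mcoeffCM mxE enum_rankK cE.
Qed.

End MpolyDependence.

(** * Homogenization *)

Section Homogenization.
Variables (R : nzRingType) (n : nat).
Implicit Types p q : {mpoly R[n.+1]}.

(** The degree is [msize p], one more than that of a nonzero p. The extra factor ['X_ord0] is
    harmless, since it is evaluated at 1. *)
Definition homogenize p :=
  \sum_(d < msize p) 'X_ord0 ^+ (msize p - d) * pihomog mdeg d p.

Lemma dhomogU (k : 'I_n.+1) : ('X_k : {mpoly R[n.+1]}) \is 1%N.-homog.
Proof. by rewrite dhomogX /= mdeg1. Qed.

Lemma homogenize_dhomog p : homogenize p \is (msize p).-homog.
Proof.
apply: rpred_sum => d _.
have hX := dhomogMn (msize p - d) (dhomogU ord0).
by have := dhomogM hX (pihomogP mdeg d p); rewrite mul1n subnK // ltnW.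
Qed.

Lemma homogenize_homog p : homogeneous (homogenize p).
Proof. by apply/homogP; exists (msize p); apply: homogenize_dhomog. Qed.

Lemma mderiv_homog p k : homogeneous p -> homogeneous p^`M(k).
Proof.
case/homogP => d /dhomogP hp; apply/homogP; exists d.-1; apply/dhomogP => m.
rewrite mcoeff_msupp mcoeff_mderiv => nz.
have /hp : (m + U_(k))%MM \in msupp p.
  by rewrite mcoeff_msupp; apply: contraNneq nz => ->; rewrite mul0rn.
by rewrite /= mdegD mdeg1 addn1 => <-.
Qed.

(** This bound on the variables makes the Jacobian of a tower of equations triangular. *)
Definition variables_le s p :=
  forall m, m \in msupp p -> forall k : 'I_n.+1, (s < k)%N -> m k = 0%N.

Lemma variables_leC s c : variables_le s c%:MP.
Proof.
move=> m; rewrite msuppC; case: ifP => // _; rewrite inE => /eqP-> k _.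
by rewrite mnm0E.
Qed.

Lemma variables_leX s (j : 'I_n.+1) : (j <= s)%N -> variables_le s 'X_j.
Proof.
move=> le_j m; rewrite msuppX inE => /eqP-> k lt_k; rewrite mnm1E.
by case: eqP lt_k => // <-; rewrite ltnNge le_j.
Qed.

Lemma variables_leD s p q :
  variables_le s p -> variables_le s q -> variables_le s (p + q).
Proof. by move=> ps qs m /msuppD_le; rewrite mem_cat => /orP[/ps|/qs]. Qed.

Lemma variables_leM s p q :
  variables_le s p -> variables_le s q -> variables_le s (p * q).
Proof.
move=> ps qs m /msuppM_le/allpairsP[[m1 m2] /= [m1p m2q ->]] k lt_k.
by rewrite mnmDE (ps _ m1p) ?(qs _ m2q).
Qed.

Lemma variables_le_mono s t p : (s <= t)%N -> variables_le s p -> variables_le t p.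
Proof. by move=> le_st ps m /ps mk k lt_k; apply: mk; apply: leq_ltn_trans lt_k. Qed.

Lemma variables_le_homogenize s p : variables_le s p -> variables_le s (homogenize p).
Proof.
move=> ps; apply: big_ind => [||d _].
- by rewrite -mpolyC0; apply: variables_leC.
- exact: variables_leD.
apply: variables_leM; last first.
  move=> m; rewrite mcoeff_msupp mcoeff_pihomog; case: ifP; rewrite ?eqxx // => _.
  by rewrite -mcoeff_msupp; apply: ps.
elim: (_ - _)%N => [|k IH]; first by rewrite expr0 -mpolyC1; apply: variables_leC.
by rewrite exprS; apply: variables_leM IH; apply: variables_leX.
Qed.

Lemma mderiv_variables_le s p (k : 'I_n.+1) : variables_le s p -> (s < k)%N -> p^`M(k) = 0.
Proof.
move=> ps lt_k; apply/mpolyP => m; rewrite mcoeff_mderiv mcoeff0.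
rewrite memN_msupp_eq0 ?mul0rn //; apply/negP => /ps/(_ k lt_k).
by rewrite mnmDE mnm1E eqxx addn1.
Qed.

Variables (S : comNzRingType) (phi : {rmorphism {mpoly R[n.+1]} -> S}).
Hypothesis phi_X0 : phi 'X_ord0 = 1.

Lemma rmorph_homogenize p : phi (homogenize p) = phi p.
Proof.
rewrite {2}(@pihomog_partitionE _ _ mdeg (msize p) p) // !rmorph_sum /=.
by apply: eq_bigr => d _; rewrite rmorphM rmorphXn phi_X0 expr1n mul1r.
Qed.

(** The powers of ['X_ord0] used as padding are constants for the derivation in any other
    variable. *)
Lemma rmorph_mderiv_homogenize p k :
  k != ord0 -> phi (homogenize p)^`M(k) = phi p^`M(k).
Proof.
move=> nz_k; rewrite {2}(@pihomog_partitionE _ _ mdeg (msize p) p) // /homogenize.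
rewrite !(raddf_sum (mderiv k)) !rmorph_sum /=; apply: eq_bigr => d _.
rewrite mderivM rmorphD !rmorphM rmorphXn phi_X0 expr1n mul1r.
rewrite (@mderiv_variables_le 0) ?rmorph0 ?mul0r ?add0r //; last by rewrite lt0n.
elim: (_ - _)%N => [|j IH]; first by rewrite expr0 -mpolyC1; apply: variables_leC.
by rewrite exprS; apply: variables_leM IH; apply: variables_leX.
Qed.

End Homogenization.

Section ToMpoly.
Variables (K : fieldType) (n : nat).

(** Variable j becomes ['X_(j+1)], since index 0 is reserved for homogenizing. *)
Definition to_mpoly k (f : itpoly K k) : {mpoly K[n.+2]} :=
  ieval (@mpolyC n.+2 K) (fun j => 'X_(inord j.+1)) k f.

Lemma rmorph_to_mpoly (S : comNzRingType) (phi : {rmorphism {mpoly K[n.+2]} -> S})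
    (kappa : {rmorphism K -> S}) (a : nat -> S) k (f : itpoly K k) :
    (k <= n.+1)%N -> (forall c, phi c%:MP = kappa c) ->
    (forall j, (j < k)%N -> phi 'X_(inord j.+1) = a j) ->
  phi (to_mpoly f) = ieval kappa a k f.
Proof.
move=> le_k phiC phiX; rewrite /to_mpoly (rmorph_ieval (kappa := kappa)) //.
by apply: eq_ieval => j lt_j /=; apply: phiX.
Qed.

Lemma variables_le_to_mpoly k (f : itpoly K k) :
  (k <= n.+1)%N -> variables_le k (to_mpoly f).
Proof.
elim: k f => [c _|k IH f lt_k]; first exact: variables_leC.
elim/itpoly_ind: f => [|f c IHf]; first by rewrite /to_mpoly rmorph0 -mpolyC0; apply: variables_leC.
rewrite /to_mpoly ievalMXaddC.
apply: variables_leD; last by apply: (@variables_le_mono _ _ k); rewrite ?leqnSn //; apply/IH/ltnW.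
by apply: variables_leM IHf _; apply: variables_leX; rewrite inordK.
Qed.

Lemma mderiv_to_mpoly k (f : {poly itpoly K k}) : (k <= n)%N ->
  (@to_mpoly k.+1 f)^`M(inord k.+1) = @to_mpoly k.+1 f^`().
Proof.
move=> le_k; elim/itpoly_ind: f => [|f c IHf].
  by rewrite deriv0 /to_mpoly rmorph0 mderiv0.
rewrite derivD derivM derivX derivC addr0 mulr1 {1}/to_mpoly ievalMXaddC.
rewrite mderivD mderivM -/(@to_mpoly k.+1 f) IHf.
rewrite (mderiv_variables_le (variables_le_to_mpoly (f := c) (leqW le_k))) ?inordK // addr0.
rewrite mderivX mnm1E eqxx scale1r.
have -> : (U_(inord k.+1) - U_(inord k.+1) = 0 :> 'X_{1..n.+2})%MM.
  by apply/mnmP => i; rewrite mnmBE subnn mnm0E.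
by rewrite mpolyX0 mulr1 /to_mpoly rmorphD ievalMX.
Qed.

End ToMpoly.

(** * The curve of a power series tower *)

Section EtaleCurve.
Variables (K : fieldType) (n : nat) (e : nat -> pser K).
Variable h : forall i, {poly itpoly K i}.
Local Notation at_series k := (ieval (@pser_const K) e k).
Hypotheses (e0 : e 0%N = pserX K).
Hypothesis h_eq0 : forall i, (0 < i <= n)%N -> at_series i.+1 (h i) = 0.
Hypothesis h_etale :
  forall i, (0 < i <= n)%N -> pcoef (at_series i.+1 (h i)^`()) 0 != 0.

Lemma hpoint_inord (R : nzRingType) (a : nat -> R) j :
  (j < n.+1)%N -> hpoint a (inord j.+1 : 'I_n.+2) = a j.
Proof. by move=> lt_j; rewrite /hpoint inordK. Qed.

Lemma evp_to_mpoly k (f : itpoly K k) :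
  (k <= n.+1)%N -> evp e (to_mpoly n f) = at_series k f.
Proof.
move=> le_k; apply: rmorph_to_mpoly => // [c|j lt_j]; first exact: evpC.
by rewrite -[LHS]/(evp e _) evpX hpoint_inord // (leq_trans lt_j).
Qed.

Lemma meval_to_mpoly (F : fieldType) (i : {rmorphism K -> F}) (a : nat -> F) k
    (f : itpoly K k) : (k <= n.+1)%N ->
  (map_mpoly i (to_mpoly n f)).@[hpoint a] = ieval i a k f.
Proof.
move=> le_k.
apply: (rmorph_to_mpoly (phi := meval (hpoint a) \o map_mpoly i)) => // [c|j lt_j] /=.
  by rewrite map_mpolyC mevalC.
by rewrite map_mpolyX mevalXU hpoint_inord // (leq_trans lt_j).
Qed.

Definition tower_eqn i := homogenize (@to_mpoly K n i.+1 (h i)).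
(* The diagonal of the triangular Jacobian of the equations. *)
Definition tower_den := 'X_ord0 * \prod_(j < n) (tower_eqn j.+1)^`M(inord j.+2).

Lemma tower_den_homog : homogeneous tower_den.
Proof.
have := @homog_prod _ _ mdeg
  ('X_ord0 :: [seq (tower_eqn j.+1)^`M(inord j.+2) | j : 'I_n]).
rewrite big_cons big_map /= big_enum; apply; rewrite /=; apply/andP; split.
  by apply/homogP; exists 1%N; apply: dhomogU.
by apply/allP => _ /mapP[j _ ->]; apply/mderiv_homog/homogenize_homog.
Qed.

Lemma evpX0 : evp e 'X_(ord0 : 'I_n.+2) = 1. Proof. by rewrite evpX. Qed.

Lemma evp_homogenize (p : {mpoly K[n.+2]}) : evp e (homogenize p) = evp e p.
Proof. exact: (rmorph_homogenize (phi := evp e) evpX0). Qed.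

Lemma evp_mderiv_homogenize (p : {mpoly K[n.+2]}) k :
  k != ord0 -> evp e (homogenize p)^`M(k) = evp e p^`M(k).
Proof. exact: (rmorph_mderiv_homogenize (phi := evp e) evpX0). Qed.

Lemma inord_neq0 j : (j < n.+1)%N -> (inord j.+1 : 'I_n.+2) != ord0.
Proof. by move=> lt_j; rewrite -val_eqE /= inordK. Qed.

Lemma evp_tower_eqn i : (0 < i <= n)%N -> evp e (tower_eqn i) = 0.
Proof.
move=> hi; rewrite /tower_eqn evp_homogenize evp_to_mpoly ?h_eq0 //.
by case/andP: hi.
Qed.

Lemma tower_eqn_form i : (0 < i <= n)%N -> curve_forms e (tower_eqn i).
Proof.
move=> hi; split; first exact: homogenize_homog.
by apply/(@curve_ideal_homog _ _ _ 0); rewrite ?homogenize_homog ?evp_tower_eqn.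
Qed.

Lemma evp_mderiv_tower_eqn i : (i <= n)%N ->
  evp e (tower_eqn i)^`M(inord i.+1) = at_series i.+1 (h i)^`().
Proof.
move=> le_i; rewrite evp_mderiv_homogenize ?inord_neq0 // -evp_to_mpoly //.
by congr (evp e _); apply: mderiv_to_mpoly.
Qed.

(** A nonzero constant term says more than a nonzero series: the specialization at t = 0 also lies
    on the curve, where it provides the rational point and the closed point of a chain. *)
Lemma evp_tower_den0 : pcoef (evp e tower_den) 0 != 0.
Proof.
rewrite -[pcoef _ _]/(pser_eval0 _) /tower_den evpM evpX0 mul1r !rmorph_prod.
apply/prodf_neq0 => j _ /=.
by rewrite -[X in pser_eval0 X]/(evp e _) evp_mderiv_tower_eqn // h_etale //=.
Qed.

Lemma evp_tower_den : evp e tower_den != 0.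
Proof. by apply: contraNneq evp_tower_den0 => ->. Qed.

Definition tower_curve := pser_curve e tower_den_homog.

Lemma map_mderiv (F : fieldType) (i : {rmorphism K -> F}) (p : {mpoly K[n.+2]}) k :
  (map_mpoly i p)^`M(k) = map_mpoly i p^`M(k).
Proof.
by apply/mpolyP => m; rewrite mcoeff_mderiv !mcoeff_map_mpoly mcoeff_mderiv raddfMn.
Qed.

(** In the columns of e_1, ..., e_n, that is of the variables with index 2 to n + 1, the Jacobian of
    the n equations is triangular, and its diagonal entries are factors of [tower_den], which does
    not vanish on the curve. *)
Lemma tower_curve_smooth : smooth tower_curve 1.
Proof.
move=> F i a [_ _ [_ [_ -> ->]]]; rewrite /tower_den rmorphM rmorph_prod mevalM rmorph_prod /=.
rewrite mulf_eq0 negb_or => /andP[_ /prodf_neq0 nz].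
exists n, (fun j => map_mpoly i (tower_eqn j.+1)); split; first by rewrite addn1.
  by move=> j; exists (tower_eqn j.+1) => //; apply: tower_eqn_form; rewrite /= ltn_ord.
set M := \matrix_(j, k) _.
(* Multiplication by B selects these n columns. *)
pose B : 'M[F]_(n.+2, n) := \matrix_(k, l) (k == inord l.+2)%:R.
have MB j l : (M *m B) j l = M j (inord l.+2).
  rewrite mxE (bigD1 (inord l.+2)) //= !mxE eqxx mulr1 big1 ?addr0 // => k ne_k.
  by rewrite !mxE (negPf ne_k) mulr0.
have detMB : \det (M *m B) != 0.
  rewrite det_trig; last first.
    apply/is_trig_mxP => j l lt_jl; rewrite MB mxE map_mderiv.
    rewrite (@mderiv_variables_le _ _ j.+2) ?rmorph0 ?meval0 //.
      by apply/variables_le_homogenize/variables_le_to_mpoly; rewrite ltnS.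
    by rewrite inordK ?ltnS.
  by apply/prodf_neq0 => j _; rewrite MB mxE map_mderiv; apply: nz.
apply/eqP; rewrite eqn_leq rank_leq_row.
have /mxrank_unit {1}<- : M *m B \in unitmx by rewrite unitmxE unitfE.
exact: mxrankM_maxl.
Qed.

(** * Bounding the dimension by transcendence degree *)

Section Dimension.
Let R := pser K.
Let sub (t : nat) (k : 'I_n.+2) : {mpoly R[n.+2]} :=
  if (k <= t)%N then (hpoint e k)%:MP * 'X_ord0 else 'X_k.

(* The kernels of subst_below t, for 1 <= t <= n.+1, form a strictly increasing
   chain of primes that ends inside the curve ideal: n drops of dimension. *)
Definition subst_below t (p : {mpoly K[n.+2]}) : {mpoly R[n.+2]} :=
  mmap (@mpolyC n.+2 R \o @pser_const K) (sub t) p.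
HB.instance Definition _ t := GRing.RMorphism.copy (subst_below t)
  (mmap (@mpolyC n.+2 R \o @pser_const K) (sub t)).

Lemma subst_belowC t c : subst_below t c%:MP = (pser_const c)%:MP.
Proof. exact: mmapC. Qed.
Lemma subst_belowX t i : subst_below t 'X_i = sub t i.
Proof. by rewrite /subst_below mmapX mmap1U. Qed.

(** The substitution at level t + 1 is that at level t followed by the substitution of one more
    variable. *)
Lemma subst_belowS t p : subst_below t p = 0 -> subst_below t.+1 p = 0.
Proof.
pose g (k : 'I_n.+2) : {mpoly R[n.+2]} :=
  if k == t.+1 :> nat then (hpoint e k)%:MP * 'X_ord0 else 'X_k.
pose psi : {mpoly R[n.+2]} -> {mpoly R[n.+2]} := mmap (@mpolyC n.+2 R) g.
have psiX k : psi 'X_k = if k == t.+1 :> nat then (hpoint e k)%:MP * 'X_ord0 else 'X_k.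
  by rewrite /psi mmapX mmap1U.
have psiM p1 p2 : psi (p1 * p2) = psi p1 * psi p2 by exact: rmorphM.
suff -> : subst_below t.+1 p = psi (subst_below t p) by move->; rewrite /psi mmap0.
rewrite /psi; apply: (@mpoly_rmorph_ext _ _ _ (subst_below t.+1)
  (mmap (@mpolyC n.+2 R) g \o subst_below t) _ _ p) => [c|k] /=.
  by rewrite !subst_belowC mmapC.
rewrite -/psi !subst_belowX /sub leq_eqVlt ltnS; have [eq_k|ne_k] /= := eqVneq (k : nat) t.+1.
  by rewrite eq_k ltnn psiX eq_k eqxx.
case: ifP => _; last by rewrite psiX (negPf ne_k).
by rewrite psiM psiX /= /psi mmapC.
Qed.

(** Once all variables are substituted, the image involves only ['X_ord0] over K[[t]]; reading that
    variable as T gives [evT]. *)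
Lemma subst_below_curve_ideal p : subst_below n.+1 p = 0 -> curve_ideal e p.
Proof.
move=> p0; apply/curve_idealE.
pose psi : {mpoly R[n.+2]} -> {poly R} := mmap polyC (fun=> 'X).
suff -> : evT e p = psi (subst_below n.+1 p) by rewrite p0 /psi mmap0.
rewrite /psi; apply: (@mpoly_rmorph_ext _ _ _ (evT e)
  (mmap polyC (fun=> 'X) \o subst_below n.+1) _ _ p) => [c|k] /=.
  by rewrite subst_belowC mmapC /evT mmapC.
rewrite subst_belowX /sub -ltnS ltn_ord /evT mmapX mmap1U.
by rewrite -/psi /psi rmorphM /= mmapC mmapX mmap1U.
Qed.

Lemma subst_below_variables t p d : p \is d.-homog -> variables_le t p ->
  subst_below t p = (evp e p)%:MP * 'X_ord0 ^+ d.
Proof.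
move=> /dhomogP hp pt; rewrite /subst_below /evp /mmap raddf_sum mulr_suml big_seq [RHS]big_seq.
apply: eq_bigr => m mp; rewrite /= rmorphM -mulrA; congr (_ * _).
rewrite -(hp _ mp) /= mdegE -prodrXr /mmap1 rmorph_prod -big_split; apply: eq_bigr => k _ /=.
rewrite /sub; case: leqP => [_|/(pt _ mp) ->]; last by rewrite !expr0 mulr1.
by rewrite exprMn rmorphXn.
Qed.

(** For the first half, keep ['X_(t+1)] as an indeterminate and evaluate everything else at the
    series: the image is [h t] over K[[t]], and it cannot be zero because its derivative at [e t] is
    not. *)
Lemma subst_below_eqn t : (0 < t <= n)%N ->
  subst_below t (tower_eqn t) <> 0 /\ subst_below t.+1 (tower_eqn t) = 0.
Proof.
move=> ht; have le_t : (t <= n)%N by case/andP: ht.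
split; last first.
  rewrite (subst_below_variables (homogenize_dhomog _)) ?evp_tower_eqn ?mul0r //.
  exact/variables_le_homogenize/variables_le_to_mpoly.
move=> eq0.
pose rho : {mpoly R[n.+2]} -> {poly R} := mmap polyC
  (fun k => if k == t.+1 :> nat then 'X else (hpoint e k)%:P).
pose b k : {poly R} := if (k < t)%N then (e k)%:P else 'X.
have rhoX (k : 'I_n.+2) : rho 'X_k = if k == t.+1 :> nat then 'X else (hpoint e k)%:P.
  by rewrite /rho mmapX mmap1U.
have rho0 : rho 'X_ord0 = 1 by rewrite rhoX.
have rhoC c : rho c%:MP = c%:P by rewrite /rho mmapC.
have rhoM p1 p2 : rho (p1 * p2) = rho p1 * rho p2 by exact: rmorphM.
have phi0 : rho (subst_below t 'X_ord0) = 1.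
  by rewrite subst_belowX /sub /= rhoM rho0 mulr1 rhoC.
have : rho (subst_below t (tower_eqn t)) = map_poly (at_series t) (h t).
  transitivity (rho (subst_below t (@to_mpoly K n t.+1 (h t)))).
    exact: (rmorph_homogenize (phi := mmap polyC _ \o subst_below t) phi0).
  transitivity (ieval (polyC \o @pser_const K) b t.+1 (h t)).
    apply: (rmorph_to_mpoly (phi := mmap polyC _ \o subst_below t)) => //=.
      by move=> c; rewrite -/rho subst_belowC rhoC.
    move=> j; rewrite ltnS => le_j; rewrite -/rho subst_belowX /sub /b.
    rewrite hpoint_inord ?inordK ?ltnS ?(leq_trans le_j) //.
    case: ltnP => lt_j; first by rewrite rhoM rho0 rhoC mulr1.
    by rewrite rhoX inordK ?ltnS ?(leq_trans le_j) // eqSS eqn_leq le_j lt_j.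
  rewrite ievalS {2}/b ltnn.
  have -> : map_poly (ieval (polyC \o @pser_const K) b t) (h t) =
      map_poly polyC (map_poly (at_series t) (h t)).
    rewrite -map_poly_comp; apply: eq_map_poly => c /=.
    rewrite (rmorph_ieval (phi := polyC) (kappa := polyC \o @pser_const K)) //.
    by apply: eq_ieval => j lt_j; rewrite /b lt_j.
  by rewrite -[LHS]/(_ \Po 'X) comp_polyXr.
rewrite eq0 /rho mmap0 => /esym/(congr1 (fun p => p^`().[e t])).
rewrite deriv0 horner0 deriv_ieval -ievalS => d0.
by have := h_etale ht; rewrite d0 eqxx.
Qed.

(** The number 3 is one more than the dimension 2 of the affine cone over a curve. Any n + 3
    polynomials in n + 2 variables are dependent, and each of the n strict inclusions between the
    kernels lowers the count by one. *)
Lemma curve_ideal_dependent : dependent_mod (@mpolyC n.+2 K) 3 (@curve_ideal K n e).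
Proof.
have step t : (t <= n)%N ->
    dependent_mod (@mpolyC n.+2 K) (n.+3 - t) (fun p => subst_below t.+1 p = 0).
  elim: t => [_|t IH lt_t].
    move=> a; have [R0 nzR R0E] := mpoly_dependent a.
    by exists R0; rewrite ?subn0 // R0E rmorph0.
  have [nz0 eq0] := @subst_below_eqn t.+1 lt_t.
  have IHt := IH (ltnW lt_t); rewrite subnS; rewrite -(@prednK (n.+3 - t)%N) in IHt.
    exact: (dependent_mod_drop (prime_ideal_kernel (subst_below t.+1))
      (prime_ideal_kernel (subst_below t.+2)) (@subst_belowS t.+1) eq0 nz0 IHt).
  by rewrite subn_gt0; apply: leq_trans lt_t _; rewrite -addn3 leq_addr.
move=> a; have := step n (leqnn n); rewrite -addn3 addKn => /(_ a)[R0 nzR].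
move=> /subst_below_curve_ideal R0I.
by exists R0.
Qed.

End Dimension.

Lemma curve_ideal_sub (P : {mpoly K[n.+2]} -> Prop) p : prime_ideal P ->
  (forall f, curve_forms e f -> P f) -> curve_ideal e p -> P p.
Proof.
move=> Pp PE /curve_forms_gen[s [sE ->]]; case: Pp => P0 _ PD _ _.
by rewrite big_seq; apply: big_ind => // q /sE/PE.
Qed.

Lemma dhomog0C (c : K) : (c%:MP : {mpoly K[n.+2]}) \is 0%N.-homog.
Proof.
apply/dhomogP => m /=; rewrite msuppC; case: ifP => // _.
by rewrite inE => /eqP->; rewrite mdeg0.
Qed.

(** A nonzero relation for ['X_j] alone has a single monomial in top degree, a nonzero multiple of a
    power of ['X_j]. A homogeneous prime contains it, and so contains every variable and is no point
    of Proj. *)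
Lemma dependent_mod1_irrelevant (P : {mpoly K[n.+2]} -> Prop) :
    prime_ideal P -> (forall p d, P p -> P (pihomog mdeg d p)) ->
    dependent_mod (@mpolyC n.+2 K) 1 P -> forall j, P 'X_j.
Proof.
move=> Pp Ph depP j; have [R nzR] := depP (fun=> 'X_j).
rewrite ievalS => /(Ph _ (size R).-1).
have -> : pihomog mdeg (size R).-1 (map_poly (@mpolyC n.+2 K) R).['X_j] =
    (lead_coef R)%:MP * 'X_j ^+ (size R).-1.
  have sz : (size (map_poly (@mpolyC n.+2 K) R) <= size R)%N by exact: size_poly.
  rewrite (horner_coef_wide _ sz) (raddf_sum (pihomog mdeg (size R).-1)).
  have lt_d : ((size R).-1 < size R)%N by rewrite prednK // size_poly_gt0.
  have hX d : (R`_d)%:MP * 'X_j ^+ d \is d.-homog.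
    have := dhomogM (dhomog0C (R`_d)) (dhomogMn d (dhomogU _ j)); by rewrite mul1n.
  rewrite (bigD1 (Ordinal lt_d)) //= coef_map (pihomog_dE (hX _)).
  rewrite [X in _ + X]big1 ?addr0 // => d ne_d.
  by rewrite coef_map /= (pihomog_ne0 _ (hX d)).
move=> RP; have [_ _ _ PM _] := Pp; apply: (prime_idealX (k := (size R).-1) Pp).
have := PM (lead_coef R)^-1%:MP _ RP.
by rewrite mulrA -mpolyCM mulVf ?lead_coef_eq0 // mul1r.
Qed.

(** The specialization at t = 0, kept as constant series so that its ideal is again a
    [curve_ideal]. *)
Definition special_series k := pser_const (pcoef (e k) 0).

Lemma evp_special (p : {mpoly K[n.+2]}) :
  evp special_series p = pser_const (pcoef (evp e p) 0).
Proof.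
apply: (mpoly_rmorph_ext (phi := evp special_series)
  (psi := @pser_const K \o (@pser_eval0 K \o evp e))) => [c|k] /=.
  by rewrite !evpC.
by rewrite !evpX /hpoint; case: eqP.
Qed.

Lemma tower_curve_has_dim1 : has_dim tower_curve 1.
Proof.
split.
  exists (fun i => if i is 0 then @curve_ideal K n e else @curve_ideal K n special_series).
  have sub (p : {mpoly K[n.+2]}) : curve_ideal e p -> curve_ideal special_series p.
    by move=> pI d; rewrite evp_special pI; apply: pserP => -[].
  split=> [[|i] _|[|//] _].
  - split; [exact: curve_ideal_prime | by move=> p d; apply: curve_ideal_pihomog |
            | by move=> f [] |].
      by exists ord0; apply: curve_ideal_X0.
    exists tower_den => //; move/(@curve_ideal_homog _ _ _ 0).
    rewrite tower_den_homog => /(_ isT) den0.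
    by have := evp_tower_den; rewrite den0 eqxx.
  - split; [exact: curve_ideal_prime | by move=> p d; apply: curve_ideal_pihomog |
            | by move=> f [_ /sub] |].
      by exists ord0; apply: curve_ideal_X0.
    exists tower_den => //; move/(@curve_ideal_homog _ _ _ 0).
    rewrite tower_den_homog => /(_ isT); rewrite evp_special => /(congr1 (fun f => pcoef f 0)).
    by move=> den0; have := evp_tower_den0; rewrite [pcoef _ _]den0 eqxx.
  (* This variable carries e_0 = t, which is a nonzero series but vanishes at t = 0. *)
  split=> //; exists 'X_(inord 1).
    apply/(@curve_ideal_homog _ _ _ 1); rewrite ?dhomogU ?orbT //.
    by rewrite evpX hpoint_inord // /special_series e0; apply: pserP => -[].
  move/(@curve_ideal_homog _ _ _ 1); rewrite dhomogU orbT => /(_ isT).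
  rewrite evpX hpoint_inord // e0 => /(congr1 (fun f => pcoef f 1)) /eqP.
  by rewrite /= oner_eq0.
(* Two strict inclusions of primes above the curve ideal lower the count from 3 to 1, which makes
   the last prime irrelevant. *)
move=> [P [Pp Psub]].
have Pprime i : (i <= 2)%N -> prime_ideal (P i) by case/Pp.
have dep3 : dependent_mod (@mpolyC n.+2 K) 3 (P 0%N).
  move=> a; have [R nzR RI] := curve_ideal_dependent a; exists R => //.
  by case: (Pp 0%N isT) => P0 _ _ PE _; apply: curve_ideal_sub RI.
have [sub1 [q1 q1P nq1P]] := Psub 0%N isT.
have [sub2 [q2 q2P nq2P]] := Psub 1%N isT.
have dep2 := dependent_mod_drop (Pprime 0%N isT) (Pprime 1%N isT) sub1 q1P nq1P dep3.
have dep1 := dependent_mod_drop (Pprime 1%N isT) (Pprime 2%N isT) sub2 q2P nq2P dep2.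
have [P2 P2h [j nPj] _ _] := Pp 2%N isT.
exact: nPj (dependent_mod1_irrelevant P2 P2h dep1 j).
Qed.

Lemma tower_curve_rational_point : exists a, rational_point tower_curve a.
Proof.
pose a : 'rV[K]_n.+2 := \row_k hpoint (fun j => pcoef (e j) 0) k.
have aE (p : {mpoly K[n.+2]}) : p.@[a ord0] = pcoef (evp e p) 0.
  apply: (mpoly_rmorph_ext (phi := meval (a ord0)) (psi := @pser_eval0 K \o evp e)) => [c|k] /=.
    by rewrite mevalC evpC.
  by rewrite mevalXU evpX mxE /hpoint; case: eqP.
exists a; split=> [|f [fh fI]|].
- apply/eqP => /rowP/(_ ord0); rewrite !mxE => /eqP.
  by rewrite oner_eq0.
- rewrite aE; move/(@curve_ideal_homog _ _ _ 0): fI.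
  by rewrite fh => /(_ isT) ->.
by exists tower_den; rewrite ?aE ?evp_tower_den0.
Qed.

Lemma root_list (p : {poly K}) : p != 0 -> exists s : seq K, forall x, root p x -> x \in s.
Proof.
have [m] := ubnP (size p); elim: m p => // m IH p; rewrite ltnS => le_p nz_p.
have [[x px]|no_root] := pselect (exists x, root p x); last first.
  by exists [::] => x px; case: no_root; exists x.
have /factor_theorem[q pE] := px.
have nz_q : q != 0 by apply: contraNneq nz_p => q0; rewrite pE q0 mul0r.
have [||s sq] := IH q => //.
  by apply: leq_trans le_p; rewrite pE size_Mmonic ?monicXsubC // size_XsubC addn2.
exists (x :: s) => y; rewrite pE rootM root_XsubC inE orbC.
by case: eqP => //= _ /sq.
Qed.

(** Over given earlier coordinates, the next one is a root of a univariate polynomial, which is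
    nonzero because its derivative does not vanish at that root. So each level multiplies the
    possibilities only by a finite number. *)
Lemma tower_points_at0 k : (k <= n)%N -> exists s : seq (nat -> K), forall b,
  b 0%N = 0 ->
  (forall i, (0 < i <= k)%N -> ieval idfun b i.+1 (h i) = 0 /\
    ieval idfun b i.+1 (h i)^`() != 0) ->
  exists2 b', b' \in s & forall i, (i <= k)%N -> b i = b' i.
Proof.
elim: k => [_|k IH lt_k].
  exists [:: fun=> 0] => b b0 _; exists (fun=> 0); rewrite ?inE // => i.
  by rewrite leqn0 => /eqP->.
have [s sP] := IH (ltnW lt_k).
have /choice[r rP] : forall p : {poly K}, exists t : seq K,
    p != 0 -> forall x, root p x -> x \in t.
  move=> p; have [->|/root_list[t tP]] := eqVneq p 0; first by exists [::].
  by exists t.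
pose pol b := map_poly (ieval (idfun : {rmorphism K -> K}) b k.+1) (h k.+1).
pose upd b x j : K := if j == k.+1 then x else b j.
exists (flatten [seq [seq upd b' x | x <- r (pol b')] | b' <- s]) => b b0 bP.
have [||b' sb' eq_b] := sP b => //.
  by move=> i /andP[i_gt0 le_i]; apply: bP; rewrite i_gt0 leqW.
have [bE bE'] := bP k.+1 (leqnn k.+1).
have polE : pol b = pol b'.
  by apply: eq_map_poly => c; apply: eq_ieval => i; rewrite ltnS => /eq_b.
exists (upd b' (b k.+1)).
  apply/flatten_mapP; exists b' => //; apply/map_f/rP; last by rewrite -polE; apply/rootP.
  rewrite -polE; apply: contraNneq bE' => p0.
  by rewrite ievalS -deriv_map -/(pol b) p0 deriv0 horner0.
by move=> i; rewrite leq_eqVlt /upd; case: eqP => [->|_] //= /eq_b.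
Qed.

Lemma meval_dhomog (p : {mpoly K[n.+2]}) d c v : p \is d.-homog ->
  p.@[fun k => c * v k] = c ^+ d * p.@[v].
Proof.
move=> /dhomogP hp; rewrite !mevalE mulr_sumr big_seq [RHS]big_seq.
apply: eq_bigr => m /hp <- /=; rewrite mulrCA; congr (_ * _).
rewrite mdegE -prodrXr -big_split; apply: eq_bigr => k _ /=.
by rewrite exprMn.
Qed.

(** Ampleness is applied with the finite list of points over t = 0 excluded, which forces t <> 0 at
    the new point. *)
Lemma ample_tower_point : ample K -> exists a : nat -> K, a 0%N != 0 /\
  forall f : itpoly K n.+1, at_series n.+1 f = 0 -> ieval idfun a n.+1 f = 0.
Proof.
move=> Kample; have [s sP] := tower_points_at0 (leqnn n).
have [|a [_ aE [_ ->]]] := Kample _ tower_curve _ tower_curve_smooth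
    tower_curve_rational_point [seq \row_k hpoint b k | b <- s].
  by split; [apply/pser_curve_variety/evp_tower_den | apply: tower_curve_has_dim1].
rewrite /tower_den mevalM mevalXU mulf_eq0 negb_or rmorph_prod /=.
move=> /andP[nz_a0 /prodf_neq0 nz_d] a_new.
(* The factor ['X_ord0] of [tower_den] makes the zeroth coordinate of the point nonzero, so b is its
   affine form. *)
pose b j := a ord0 (inord j.+1) / a ord0 ord0.
have ab k : a ord0 k = a ord0 ord0 * hpoint b k.
  rewrite /hpoint; case: eqP => [k0|/eqP nz_k].
    by rewrite mulr1; congr (a _ _); apply: val_inj.
  rewrite /b mulrC divfK // prednK ?lt0n //; congr (a _ _); apply: val_inj.
  by rewrite /= inordK ?ltn_ord.
have scale (p : {mpoly K[n.+2]}) : homogeneous p -> (p.@[a ord0] == 0) = (p.@[hpoint b] == 0).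
  case/homogP => d hp; rewrite (meval_eq _ ab) (meval_dhomog _ _ hp).
  by rewrite mulf_eq0 expf_eq0 (negPf nz_a0) andbF.
have b_X0 : (meval (hpoint b)) 'X_(ord0 : 'I_n.+2) = 1 by rewrite mevalXU.
have b_to_mpoly k (f : itpoly K k) : (k <= n.+1)%N ->
    (to_mpoly n f).@[hpoint b] = ieval idfun b k f.
  move=> le_k; rewrite -(meval_to_mpoly idfun) //; congr (_.@[_]).
  by apply/mpolyP => m; rewrite mcoeff_map_mpoly.
have bE k (f : itpoly K k) : (k <= n.+1)%N -> at_series k f = 0 -> ieval idfun b k f = 0.
  move=> le_k f0; rewrite -b_to_mpoly // -(rmorph_homogenize (phi := meval (hpoint b))) //.
  apply/eqP; rewrite -[X in X == _]/((homogenize (to_mpoly n f)).@[hpoint b]).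
  rewrite -scale ?homogenize_homog // aE //.
  split; first exact: homogenize_homog.
  apply/(@curve_ideal_homog _ _ _ 0); rewrite ?homogenize_homog //.
  by rewrite evp_homogenize evp_to_mpoly.
exists b; split; last by move=> f; apply: (bE n.+1 f).
(* If t were 0, the point would be on the excluded list; the remaining factors of [tower_den] give
   the nonvanishing derivatives required there. *)
apply/negP => /eqP b0; have [i /andP[i_gt0 le_i]|b' sb' eq_b] := sP b b0.
  split; first by apply: (bE i.+1 (h i)); rewrite ?h_eq0 ?i_gt0 ?ltnS.
  case: i i_gt0 le_i => // i _ lt_i.
  have := nz_d (Ordinal lt_i) isT; rewrite scale ?mderiv_homog ?homogenize_homog //.
  have := rmorph_mderiv_homogenize (phi := meval (hpoint b)) b_X0
     (@to_mpoly K n i.+2 (h i.+1)) (inord_neq0 (j := i.+1) lt_i).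
  rewrite -[LHS]/((tower_eqn i.+1)^`M(inord i.+2)).@[hpoint b] => ->.
  rewrite -(b_to_mpoly i.+2 (h i.+1)^`()) //.
  by have -> : (@to_mpoly K n i.+2 (h i.+1))^`M(inord i.+2) = @to_mpoly K n i.+2 (h i.+1)^`()
    by apply: mderiv_to_mpoly.
have /negP := a_new (\row_k hpoint b' k) (map_f _ sb') (a ord0 ord0); apply.
apply/eqP/rowP => k; rewrite !mxE [LHS]ab; congr (_ * _).
rewrite /hpoint; case: eqP => // /eqP nz_k; apply: eq_b.
by rewrite -ltnS prednK ?lt0n // -ltnS.
Qed.

End EtaleCurve.

(** * Perfect fields *)

Section PerfectField.
Variable K : fieldType.
Hypothesis Kperfect : perfect_field K.

Lemma irreducible_factor (P : {poly K}) : (1 < size P)%N ->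
  exists2 g, irreducible_poly g & g %| P.
Proof.
have [m] := ubnP (size P); elim: m P => // m IH P; rewrite ltnS => le_P gt1_P.
have [irrP|] := pselect (irreducible_poly P); first by exists P.
move=> nirr; have [q qP [sq nq]] : exists2 q, q %| P & size q != 1%N /\ ~~ (q %= P).
  apply: contrapT => none; apply: nirr; split=> // q sq qP.
  by apply: contrapT => /negP nq; apply: none; exists q.
have nzP : P != 0 by rewrite -size_poly_gt0 ltnW.
have lt_q : (size q < size P)%N.
  rewrite ltn_neqAle dvdp_leq // andbT; apply: contraNneq nq => sz.
  by rewrite -dvdp_size_eqp // sz.
have nzq : q != 0 by apply: contraNneq nzP => q0; rewrite -dvd0p -q0.
have gt1_q : (1 < size q)%N by rewrite ltn_neqAle eq_sym sq size_poly_gt0.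
have [g irr_g gq] := IH q (leq_trans lt_q le_P) gt1_q.
by exists g => //; apply: dvdp_trans qP.
Qed.

Lemma multiplicity_decomposition (g P : {poly K}) : P != 0 -> (1 < size g)%N ->
  exists k r, P = g ^+ k * r /\ ~~ (g %| r).
Proof.
move=> nzP gt1_g; have nzg : g != 0 by rewrite -size_poly_gt0 ltnW.
have [m] := ubnP (size P); elim: m P nzP => // m IH P nzP; rewrite ltnS => le_P.
have [gP|] := boolP (g %| P); last by exists 0%N, P; rewrite expr0 mul1r.
case/dvdpP: (gP) => q Pq; have nzq : q != 0 by apply: contraNneq nzP => q0; rewrite Pq q0 mul0r.
have [|k [r [qE nr]]] := IH q nzq.
  apply: leq_trans le_P; rewrite Pq size_mul // -subn1 ltn_subRL.
  by rewrite addnC ltn_add2l.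
by exists k.+1, r; split=> //; rewrite Pq qE mulrAC -exprSr.
Qed.

(* If g is an irreducible, hence separable, factor of X^p - a, then comparing
   derivatives in X^p - a = g^k r shows that p divides k, so g is linear. *)
Lemma perfect_pth_root p (a : K) : p \in [pchar K] -> exists b, b ^+ p = a.
Proof.
move=> charp; have p_gt1 := prime_gt1 (pcharf_prime charp).
have p_gt0 := ltnW p_gt1.
have sP : size ('X^p - a%:P) = p.+1 by rewrite size_XnsubC.
have nzP : 'X^p - a%:P != 0 by rewrite -size_poly_gt0 sP.
have [|g irr_g gP] := @irreducible_factor ('X^p - a%:P); first by rewrite sP ltnS.
have [gt1_g _] := irr_g; have sep : coprimep g g^`() by have := Kperfect irr_g; rewrite unlock.
have nzg : g != 0 by rewrite -size_poly_gt0 ltnW.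
have [k [r [PE nr]]] := multiplicity_decomposition nzP gt1_g.
have nzr : r != 0 by apply: contraNneq nr => ->; rewrite dvdp0.
have k_gt0 : (0 < k)%N.
  by case: k PE => // PE; move: gP nr; rewrite PE expr0 mul1r => ->.
have pk : (p %| k)%N.
  rewrite (dvdn_pcharf charp); apply: contraNT nr => nzk.
  have : ('X^p - a%:P)^`() = 0.
    by rewrite derivB derivXn derivC subr0 -mulr_natr -polyC_natr (pcharf0 charp) polyC0 mulr0.
  have -> : ('X^p - a%:P)^`() = g ^+ k.-1 * (g^`() *+ k * r + g * r^`()).
    have gk : g ^+ k = g ^+ k.-1 * g by rewrite -exprSr prednK.
    rewrite PE derivM deriv_exp gk -mulrnAl.
    by set y := _ *+ k; ring.
  move/eqP; rewrite mulf_eq0 expf_eq0 (negPf nzg) andbF /= addr_eq0 => /eqP gr.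
  have : g %| (k%:R *: (g^`() * r)).
    by rewrite scaler_nat -mulrnAl gr dvdpNr dvdp_mulIl.
  by rewrite dvdpZr // (Gauss_dvdpr _ sep).
have sg : size g = 2%N.
  have : (size (g ^+ k) <= p.+1)%N.
    by rewrite -sP; apply: dvdp_leq => //; rewrite PE dvdp_mulIl.
  rewrite -(@prednK (size (g ^+ k))) ?size_poly_gt0 ?expf_neq0 // ltnS size_exp.
  move=> le_gk; have le_pk := dvdn_leq k_gt0 pk.
  have : ((size g).-1 * p <= 1 * p)%N.
    by rewrite mul1n; apply: leq_trans le_gk; rewrite leq_mul2l le_pk orbT.
  rewrite leq_pmul2r // => le1; apply/eqP; rewrite eqn_leq gt1_g andbT.
  by rewrite -(@prednK (size g)) // ltnW.
have [b gb] := poly2_root sg; exists b.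
have : root ('X^p - a%:P) b := root_dvdp gP gb.
by rewrite /root !hornerE subr_eq0 => /eqP.
Qed.

(** Characteristic 0 is fitted into the same data with p = 1 and identity maps; the last clause
    separates the two cases where separability is proved. *)
Lemma perfect_frobenius : exists p (r phi : {rmorphism K -> K}),
  [/\ forall x, phi x = x ^+ p, cancel r phi, cancel phi r
    & (forall k, k%:R = 0 :> K -> k = 0%N) \/ p \in [pchar K]].
Proof.
have [[p charp]|nochar] := pselect (exists p, p \in [pchar K]); last first.
  exists 1%N, idfun, idfun; split=> //; left=> k k0; apply/eqP; rewrite -leqn0 leqNgt.
  by apply/negP => k_gt0; apply/nochar/(natf0_pchar k_gt0)/eqP.
have /choice[s sK] a := perfect_pth_root a charp.
pose phi : {rmorphism K -> K} := pFrobenius_aut charp.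
have phiE x : phi x = x ^+ p by [].
have sphi : cancel s phi by move=> x; rewrite phiE sK.
have phis : cancel phi s by move=> x; apply: (fmorph_inj phi); rewrite sphi.
have s_zmod : zmod_morphism s.
  by move=> x y; apply: (fmorph_inj phi); rewrite rmorphB /= !sphi.
have s_monoid : monoid_morphism s.
  split=> [|x y]; apply: (fmorph_inj phi); first by rewrite sphi rmorph1.
  by rewrite rmorphM /= !sphi.
pose r : {rmorphism K -> K} := HB.pack s
  (GRing.isZmodMorphism.Build K K s s_zmod) (GRing.isMonoidMorphism.Build K K s s_monoid).
by exists p, r, phi; split=> //; right.
Qed.
End PerfectField.

(** * Generic towers *)

Section ItpolyMap.
Variables (K : fieldType).

Fixpoint itmap (s : {rmorphism K -> K}) k : {rmorphism itpoly K k -> itpoly K k} :=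
  match k with
  | 0 => s
  | k'.+1 => map_poly (itmap s k')
  end.

Lemma itmapS s k (f : {poly itpoly K k}) : itmap s k.+1 f = map_poly (itmap s k) f.
Proof. by []. Qed.

Lemma itmapK (s t : {rmorphism K -> K}) k : cancel s t -> cancel (itmap s k) (itmap t k).
Proof.
move=> sK; elim: k => [//|k IH] f; rewrite !itmapS -map_poly_comp.
by apply: map_poly_id => c _; apply: IH.
Qed.

Lemma ieval_itmap (s : {rmorphism K -> K}) (a : nat -> K) k (f : itpoly K k) :
  ieval idfun (s \o a) k (itmap s k f) = s (ieval idfun a k f).
Proof.
elim: k f => [//|k IH] f; rewrite !ievalS /= itmapS -horner_map -!map_poly_comp.
by congr (_.[_]); apply: eq_map_poly => c /=; apply: IH.
Qed.

End ItpolyMap.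
#[local] Arguments itmap : simpl never.

Section GenericTower.
Variables (K : fieldType) (I : Type) (U : (I -> Prop) -> Prop).
Hypothesis U_mono : forall A B : I -> Prop, (forall x, A x -> B x) -> U A -> U B.
Hypothesis U_and : forall A B : I -> Prop, U A -> U B -> U (fun x => A x /\ B x).
Implicit Types (z : nat -> I -> K) (k : nat).

Local Notation val_at z k x := (ieval (idfun : {rmorphism K -> K}) (fun j => z j x) k).

(** When U is an ultrafilter, this says that f vanishes at the point (z_0, ..., z_(k-1)) of the
    ultrapower of K. *)
Definition generically0 z k (f : itpoly K k) := U (fun x => val_at z k x f = 0).

Definition transcendental z k :=
  forall f : {poly itpoly K k}, @generically0 z k.+1 f -> forall c, @generically0 z k f`_c.

(** The last clause expresses minimality of the degree of h; it disposes of remainders after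
    pseudo-division by h. *)
Definition separably_algebraic z k := exists h : {poly itpoly K k},
  [/\ @generically0 z k.+1 h, ~ @generically0 z k.+1 h^`(),
      ~ @generically0 z k (lead_coef h)
    & forall f : {poly itpoly K k}, (size f < size h)%N -> @generically0 z k.+1 f ->
      forall c, @generically0 z k f`_c].

Definition separable_tower z k :=
  forall i, (i < k)%N -> transcendental z i \/ separably_algebraic z i.

Lemma eq_generically0 z z' k (f : itpoly K k) :
  (forall j, (j < k)%N -> z j = z' j) -> generically0 z f -> generically0 z' f.
Proof.
move=> eq_z; apply: U_mono => x <-; apply: eq_ieval => j /eq_z -> //.
Qed.

Lemma eq_separable_tower z z' k :
  (forall j, (j < k)%N -> z j = z' j) -> separable_tower z k -> separable_tower z' k.
Proof.
move=> eq_z tz i lt_i.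
have eqS j : (j < i.+1)%N -> z j = z' j by move=> lt_j; apply/eq_z/(leq_trans lt_j).
have eqi j : (j < i)%N -> z j = z' j by move=> lt_j; apply: eqS; apply: leqW.
have eqS' j : (j < i.+1)%N -> z' j = z j by move/eqS.
have eqi' j : (j < i)%N -> z' j = z j by move/eqi.
case: (tz i lt_i) => [tr|[h [h0 dh lh hmin]]]; [left|right].
  move=> f /(eq_generically0 eqS')/tr f0 c.
  exact: eq_generically0 (f0 c).
exists h; split.
- exact: eq_generically0 h0.
- by move/(eq_generically0 eqS').
- by move/(eq_generically0 eqi').
move=> f lt_f /(eq_generically0 eqS')/(hmin f lt_f) f0 c.
exact: eq_generically0 (f0 c).
Qed.

Lemma generically0_iff z z' k k' (f : itpoly K k) (f' : itpoly K k') :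
  (forall x, val_at z k x f = 0 <-> val_at z' k' x f' = 0) ->
  generically0 z f <-> generically0 z' f'.
Proof. by move=> eq_f; split; apply: U_mono => x /eq_f. Qed.

Section Automorphism.
Variables (s t : {rmorphism K -> K}) (sK : cancel s t) (tK : cancel t s).
Local Notation sz z := (fun j x => s (z j x)).

Lemma generically0_itmap z k (f : itpoly K k) :
  generically0 (sz z) (itmap s k f) <-> generically0 z f.
Proof.
apply: generically0_iff => x; rewrite (ieval_itmap s (fun j => z j x)).
by split=> [/eqP|->]; rewrite ?rmorph0 // fmorph_eq0 => /eqP.
Qed.

(** An automorphism acting on the coordinates and on the coefficients matches relations bijectively
    and keeps degrees. *)
Lemma separable_tower_automorphism z k :
  separable_tower z k -> separable_tower (sz z) k.
Proof.
have ontoP i (f : {poly itpoly K i}) : exists2 f0 : {poly itpoly K i},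
    f = map_poly (itmap s i) f0 & size f0 = size f.
  exists (map_poly (itmap t i) f).
    rewrite -map_poly_comp; apply/esym/map_poly_id => c _ /=.
    by rewrite (itmapK tK).
  by apply: size_map_inj_poly; [apply: can_inj (itmapK (k := i) tK) | apply: rmorph0].
move=> tz i /tz[tr|[h [h0 dh lh hmin]]]; [left|right].
  move=> f; have [f0 -> _] := ontoP i f.
  rewrite -itmapS generically0_itmap => /tr f0z c.
  by rewrite itmapS coef_map generically0_itmap.
have sh : size (map_poly (itmap s i) h) = size h.
  by apply: size_map_inj_poly; [apply: can_inj (itmapK (k := i) sK) | apply: rmorph0].
exists (map_poly (itmap s i) h); split.
- by rewrite -itmapS generically0_itmap.
- by rewrite deriv_map -itmapS generically0_itmap.
- by rewrite lead_coefE sh coef_map generically0_itmap.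
move=> f; have [f0 -> <-] := ontoP i f; rewrite sh => lt_f.
rewrite -itmapS generically0_itmap => /(hmin f0 lt_f) f0z c.
by rewrite itmapS coef_map generically0_itmap.
Qed.

End Automorphism.

(** Generically zero leading terms are cut off one at a time; a coefficient that is not generically
    zero stops the process. *)
Lemma generically0_trim z k (f : {poly itpoly K k}) :
    @generically0 z k.+1 f -> (exists c, ~ @generically0 z k f`_c) ->
  exists f' : {poly itpoly K k}, [/\ (size f' <= size f)%N, @generically0 z k.+1 f'
    & ~ @generically0 z k (lead_coef f')].
Proof.
have [m] := ubnP (size f); elim: m f => // m IH f; rewrite ltnS => le_f f0 [c nf].
have [l0|] := pselect (@generically0 z k (lead_coef f)); last by exists f.
have nzf : f != 0.
  by apply: contra_notN nf => /eqP ->; rewrite coef0; apply: (U_mono _ f0) => x _; rewrite rmorph0.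
pose f1 := take_poly (size f).-1 f.
have fE : f = f1 + lead_coef f *: 'X^((size f).-1).
  apply/polyP => i; rewrite coefD coefZ coefXn coef_take_poly.
  have [lt_i|le_i] := ltnP i (size f).-1; first by rewrite (ltn_eqF lt_i) mulr0 addr0.
  rewrite add0r; have [->|ne_i] := eqVneq i (size f).-1; first by rewrite mulr1.
  rewrite mulr0 nth_default // -(@prednK (size f)) ?size_poly_gt0 //.
  by rewrite ltn_neqAle eq_sym ne_i.
have lt_f1 : (size f1 < size f)%N.
  by apply: leq_ltn_trans (size_take_poly _ _) _; rewrite prednK // size_poly_gt0.
have [||f' [le_f' f'0 nf']] := IH f1 (leq_trans lt_f1 le_f).
- apply: (U_mono _ (U_and f0 l0)) => x [+ lx]; rewrite {1}fE.
  by rewrite !ievalS rmorphD hornerD /= map_polyZ hornerZ lx mul0r addr0.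
- exists c => f1c; apply: nf; rewrite fE coefD coefZ coefXn.
  apply: (U_mono _ (U_and f1c l0)) => x [f1x lx].
  by rewrite rmorphD rmorphM /= f1x lx mul0r addr0.
by exists f'; split=> //; apply: leq_trans le_f' (ltnW lt_f1).
Qed.

Variables (p : nat) (r phi : {rmorphism K -> K}).
Hypotheses (phiE : forall x, phi x = x ^+ p) (rK : cancel r phi) (phiK : cancel phi r).
Hypothesis charK : (forall k, k%:R = 0 :> K -> k = 0%N) \/ p \in [pchar K].

Lemma separable_tower_iter z k m :
  separable_tower z k -> separable_tower (fun j x => iter m r (z j x)) k.
Proof.
move=> tz; elim: m => [//|m IH].
exact: (separable_tower_automorphism rK phiK IH).
Qed.

Lemma iter_frobenius m x : (iter m r x) ^+ (p ^ m) = x.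
Proof.
elim: m x => [|m IH] x; first by rewrite expn0 expr1.
by rewrite iterS expnS exprM -phiE rK IH.
Qed.

Definition set_coord z k (v : I -> K) j := if j == k then v else z j.

Lemma set_coord_eq z k v : set_coord z k v k = v.
Proof. by rewrite /set_coord eqxx. Qed.

Lemma set_coord_lt z k v j : (j < k)%N -> set_coord z k v j = z j.
Proof. by rewrite /set_coord => /ltn_eqF ->. Qed.

Lemma val_at_set_coord z k v x (f : {poly itpoly K k}) :
  val_at (set_coord z k v) k.+1 x f = (map_poly (val_at z k x) f).[v x].
Proof.
rewrite ievalS set_coord_eq; congr (_.[_]); apply: eq_map_poly => c.
by apply: eq_ieval => j lt_j; rewrite set_coord_lt.
Qed.

Lemma generically0_set_coord z k v (f : itpoly K k) :
  generically0 (set_coord z k v) f <-> generically0 z f.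
Proof.
by split; apply: eq_generically0 => j lt_j; rewrite set_coord_lt.
Qed.

(* Generically h is a polynomial in 'X^p, and extracting p-th roots of its
   coefficients divides its degree by p. *)
Lemma generically0_contract z k v (h : {poly itpoly K k}) :
    p \in [pchar K] -> (1 < size h)%N ->
    @generically0 (set_coord z k v) k.+1 h ->
    (forall c, ~~ (p %| c)%N -> @generically0 z k h`_c) ->
    ~ @generically0 z k (lead_coef h) ->
  exists h' : {poly itpoly K k}, [/\ (size h' < size h)%N,
    @generically0 (set_coord (fun j x => r (z j x)) k v) k.+1 h'
    & exists c, ~ @generically0 (fun j x => r (z j x)) k h'`_c].
Proof.
move=> charp gt1_h h0 hc lh; have p_gt1 := prime_gt1 (pcharf_prime charp).
have p_gt0 := ltnW p_gt1; set N := (size h).-1.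
have N_gt0 : (0 < N)%N by rewrite -ltnS prednK // ltnW.
have sh : size h = N.+1 by rewrite prednK // ltnW.
have pN : (p %| N)%N by apply: contra_notT lh => /hc.
(* Generically h is [h1] in ['X^p]. The bound N is generous, and suffices because N / p < N. *)
pose h1 := \poly_(c < N) h`_(p * c).
exists (map_poly (itmap r k) h1); split.
- by rewrite sh ltnS (leq_trans (size_poly _ _)) // size_poly.
- have hcN : U (fun x => forall c, (c < N.+1)%N -> ~~ (p %| c)%N -> val_at z k x h`_c = 0).
    elim: N.+1 => [|n IH]; first by apply: (U_mono _ h0) => x _ c.
    have Un : U (fun x => ~~ (p %| n)%N -> val_at z k x h`_n = 0).
      by case: (boolP (p %| n)%N) => [_|/hc hn]; [apply: (U_mono _ h0) | apply: (U_mono _ hn)].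
    apply: (U_mono _ (U_and IH Un)) => x [IHx nx] c; rewrite ltnS leq_eqVlt.
    by case/predU1P => [->|]; [apply: nx | apply: IHx].
  apply: (U_mono _ (U_and h0 hcN)) => x [h0x hx]; rewrite val_at_set_coord.
  rewrite val_at_set_coord in h0x; set P := map_poly _ h in h0x.
  pose Q := map_poly (val_at z k x) h1.
  have PQ : P = Q \Po 'X^p.
    apply/polyP => c; rewrite coef_comp_poly_Xn // coef_map /=.
    case: ifP => [pc|/negbT npc]; last first.
      have [lt_c|ge_c] := ltnP c N.+1; first exact: hx.
      by rewrite nth_default ?rmorph0 // sh.
    rewrite coef_map coef_poly mulnC divnK //; case: ltnP => // le_c.
    suff -> : h`_c = 0 by [].
    apply: nth_default; rewrite sh.
    have [c0|c_gt0] := posnP c; first by move: le_c; rewrite c0 div0n leqNgt N_gt0.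
    apply: leq_trans (_ : (c %/ p < c)%N) => //.
    by rewrite ltn_Pdiv.
  have -> : map_poly (ieval idfun (fun j => r (z j x)) k) (map_poly (itmap r k) h1) =
      map_poly r Q.
    rewrite -!map_poly_comp; apply: eq_map_poly => c /=.
    exact: (ieval_itmap r (fun j => z j x)).
  (* As v = r(v^p), the new polynomial takes at v the value r(Q(v^p)) = r(P(v)) = 0. *)
  rewrite -(phiK (v x)) horner_map phiE.
  by move: h0x; rewrite PQ horner_comp hornerXn => ->; rewrite rmorph0.
exists (N %/ p)%N; rewrite coef_map coef_poly ltn_Pdiv // mulnC divnK //.
by move/generically0_itmap.
Qed.

(* A relation of minimal degree for v over all p^m-th roots of the tower is
   separable. *)
Lemma separable_tower_extend z k v : separable_tower z k ->
  exists m, separable_tower (set_coord (fun j x => iter m r (z j x)) k v) k.+1.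
Proof.
move=> tz.
pose root_tower m j x := iter m r (z j x).
pose relation d := exists m (f : {poly itpoly K k}), [/\ size f = d,
  @generically0 (set_coord (root_tower m) k v) k.+1 f
  & ~ @generically0 (root_tower m) k (lead_coef f)].
have low m : separable_tower (set_coord (root_tower m) k v) k.
  by apply: eq_separable_tower (separable_tower_iter m tz) => j lt_j; rewrite set_coord_lt.
have relP m (f : {poly itpoly K k}) : @generically0 (set_coord (root_tower m) k v) k.+1 f ->
    (exists c, ~ @generically0 (root_tower m) k f`_c) -> exists2 d, (d <= size f)%N & relation d.
  move=> f0 [c nf]; have [|f' [le_f' f'0 nf']] := @generically0_trim _ k f f0.
    by exists c; rewrite generically0_set_coord.
  by exists (size f') => //; exists m, f'; split=> // /(generically0_set_coord _ v)/nf'.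
have [[d0 rel0]|norel] := pselect (exists d, relation d); last first.
  exists 0%N => i; rewrite ltnS leq_eqVlt => /predU1P[->|]; last exact: (low 0%N).
  left=> f f0 c; apply: contrapT => nf; apply: norel.
  have [|d _ reld] := relP 0%N f f0; last by exists d.
  by exists c; rewrite -(@generically0_set_coord _ _ v).
have ex_d : exists d, `[< relation d >] by exists d0; apply/asboolP.
case: (ex_minnP ex_d) => d /asboolP[m [h [sh h0 lh]]] d_min.
have hmin m' (f : {poly itpoly K k}) : (size f < d)%N ->
    @generically0 (set_coord (root_tower m') k v) k.+1 f ->
    forall c, @generically0 (root_tower m') k f`_c.
  move=> lt_f f0 c; apply: contrapT => nf.
  have [|d' le_d' reld'] := relP m' f f0; first by exists c.
  have /d_min le_d : `[< relation d' >] by apply/asboolP.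
  by move: (leq_trans le_d le_d'); rewrite leqNgt lt_f.
exists m => i; rewrite ltnS leq_eqVlt => /predU1P[->|]; last exact: (low m).
right; exists h; split=> //; last 2 first.
- by rewrite generically0_set_coord.
- move=> f; rewrite sh => lt_f f0 c; rewrite generically0_set_coord.
  exact: (hmin m f lt_f f0 c).
(* By minimality a generically zero derivative has generically zero coefficients. In characteristic
   0 this kills the leading coefficient of h; otherwise contraction gives a shorter relation at
   level m + 1. *)
move=> dh0.
have gt1_h : (1 < size h)%N.
  rewrite ltnNge; apply/negP => /size1_polyC hC; apply: lh.
  move: h0; rewrite hC lead_coefC; apply: U_mono => x.
  by rewrite val_at_set_coord map_polyC hornerC.
have lt_dh : (size h^`() < d)%N by rewrite -sh lt_size_deriv // -size_poly_gt0 ltnW.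
have dhc := hmin m _ lt_dh dh0.
have hc c : c.+1%:R != 0 :> K -> @generically0 (root_tower m) k h`_c.+1.
  move=> nzc; apply: (U_mono _ (dhc c)) => x; rewrite coef_deriv rmorphMn /= => /eqP.
  by rewrite -mulr_natr mulf_eq0 (negPf nzc) orbF => /eqP.
have lhE : lead_coef h = h`_(size h).-2.+1 by rewrite lead_coefE prednK // -subn1 subn_gt0.
case: charK => [char0|charp].
  by apply: lh; rewrite lhE; apply: hc; apply/eqP => /char0.
have [|h' [lt_h' h'0 [c nh']]] := generically0_contract charp gt1_h h0 _ lh.
  case=> [|c]; first by rewrite dvdn0.
  by rewrite (dvdn_pcharf charp) => /hc.
by apply: nh'; apply: (hmin m.+1 h' _ h'0); rewrite -sh.
Qed.

(** Adding a coordinate may require further p-th roots of all earlier ones, whose exponents then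
    grow by m, while the new coordinate starts with exponent 0. *)
Lemma separable_tower_exists (v : nat -> I -> K) k : exists z (q : nat -> nat),
  separable_tower z k /\ forall j x, (j < k)%N -> v j x = (z j x) ^+ (p ^ q j).
Proof.
elim: k => [|k [z [q [tz zv]]]]; first by exists (fun _ _ => 0), (fun=> 0%N); split.
have [m tm] := separable_tower_extend (v k) tz.
exists (set_coord (fun j x => iter m r (z j x)) k (v k)).
exists (fun j => if j == k then 0 else (m + q j))%N; split=> // j x.
rewrite ltnS leq_eqVlt => /predU1P[->|lt_j]; first by rewrite eqxx set_coord_eq expn0 expr1.
by rewrite (ltn_eqF lt_j) set_coord_lt // expnD exprM iter_frobenius zv.
Qed.

End GenericTower.

(** * Power series specializations *)

Definition iaffine (K : fieldType) k (c b : K) j : itpoly K k :=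
  iconst K k c + iconst K k b * ivar K k j.

Lemma ieval_iaffine (K : fieldType) (R : comNzRingType) (iota : {rmorphism K -> R})
    (a : nat -> R) k c b j :
  (j < k)%N -> ieval iota a k (iaffine k c b j) = iota c + iota b * a j.
Proof. by move=> lt_j; rewrite rmorphD rmorphM !ieval_iconst ieval_ivar. Qed.

Section EtaleOver.
Variable K : fieldType.
Implicit Types (e : nat -> pser K) (y : pser K).
Local Notation at_series e k := (ieval (@pser_const K) e k).

Lemma pcoef0_ieval e k (f : itpoly K k) :
  pcoef (at_series e k f) 0 = ieval idfun (fun j => pcoef (e j) 0) k f.
Proof. exact: (rmorph_ieval (phi := @pser_eval0 K) (kappa := idfun)). Qed.

(** A root that is simple at t = 0, which is the shape of equation required of the tower of a
    curve. *)
Definition etale_over e i y := exists h : {poly itpoly K i},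
  (map_poly (at_series e i) h).[y] = 0 /\
  pcoef (map_poly (at_series e i) h^`()).[y] 0 != 0.

Lemma etale_over_ieval e i (g : itpoly K i) : etale_over e i (at_series e i g).
Proof.
exists ('X - g%:P); rewrite derivB derivX derivC subr0 rmorphB rmorph1 /=.
by rewrite map_polyX map_polyC hornerXsubC subrr hornerC /= oner_eq0.
Qed.

(** The equation g y = 1 has derivative g, so Hensel lifting produces the inverse together with its
    etale equation. *)
Lemma etale_over_inv e i (g : itpoly K i) : pcoef (at_series e i g) 0 != 0 ->
  exists2 y, etale_over e i y & at_series e i g * y = 1.
Proof.
set gs := at_series e i g => nz_g.
pose H : {poly pser K} := gs *: 'X - 1.
have dH : H^`() = gs%:P by rewrite /H derivB derivZ derivX -polyC1 derivC subr0 alg_polyC.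
have HE y : H.[y] = gs * y - 1 by rewrite /H !hornerE.
have [||y _ Hy] := @hensel _ H (pcoef gs 0)^-1.
- rewrite HE pcoefB mulrC pcoef_constM mulVf //; exact: subrr.
- by rewrite dH hornerC.
exists y; last by apply/eqP; rewrite -subr_eq0 -HE Hy.
exists (g *: 'X - 1); rewrite derivB derivZ derivX -polyC1 derivC subr0 alg_polyC.
rewrite rmorphB /= map_polyZ map_polyX !map_polyC /= hornerC -/gs rmorph1.
by rewrite -[_ - _]/(gs *: 'X - 1%:P) polyC1.
Qed.

(** An etale equation can be carried along S when the images of the old coordinates are polynomials
    in the new ones. This serves to reindex coordinates and to substitute b t for t. *)
Lemma etale_over_rmorph e i y e' i' (S : {rmorphism pser K -> pser K}) :
    (forall c, S (pser_const c) = pser_const c) ->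
    (forall f, pcoef (S f) 0 = pcoef f 0) ->
    (forall j, (j < i)%N -> exists g : itpoly K i', S (e j) = at_series e' i' g) ->
  etale_over e i y -> etale_over e' i' (S y).
Proof.
move=> SC S0 Se [h [h0 dh]].
have /choice[g gP] : forall j, exists g : itpoly K i', (j < i)%N -> S (e j) = at_series e' i' g.
  by move=> j; have [/Se[g gE]|_] := ltnP j i; [exists g | exists 0].
pose rho : {rmorphism itpoly K i -> itpoly K i'} := ieval (iconst K i') g i.
have rhoE c : at_series e' i' (rho c) = S (at_series e i c).
  rewrite /rho (rmorph_ieval (kappa := @pser_const K)) => [|x]; last exact: ieval_iconst.
  rewrite (rmorph_ieval (phi := S) (kappa := @pser_const K)) => [|x]; last exact: SC.
  by apply: eq_ieval => j /gP /= ->.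
have rho_poly (q : {poly itpoly K i}) :
    (map_poly (at_series e' i') (map_poly rho q)).[S y] = S (map_poly (at_series e i) q).[y].
  rewrite -horner_map /= -!map_poly_comp; congr (_.[_]).
  by apply: eq_map_poly => c /=; apply: rhoE.
exists (map_poly rho h); rewrite deriv_map !rho_poly h0 rmorph0 S0; split=> //.
Qed.

End EtaleOver.

Section TowerSeries.
Variables (K : fieldType) (I : Type) (U : (I -> Prop) -> Prop).
Hypothesis U_mono : forall A B : I -> Prop, (forall x, A x -> B x) -> U A -> U B.
Hypothesis U_and : forall A B : I -> Prop, U A -> U B -> U (fun x => A x /\ B x).
Hypothesis U_or : forall A : I -> Prop, U A \/ U (fun x => ~ A x).
Hypothesis U_nonempty : ~ U (fun=> False).
Local Notation at_series e k := (ieval (@pser_const K) e k).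

Let ngenerically0 z k (f : itpoly K k) : ~ generically0 U z f ->
  U (fun x => ieval idfun (fun j => z j x) k f <> 0).
Proof. by case: (U_or (fun x => ieval idfun (fun j => z j x) k f = 0)). Qed.

(** The series are built coordinate by coordinate, for almost every x: s_0 + t at the start, a
    constant for a transcendental coordinate, and a Hensel lift for a separably algebraic one. *)
Lemma tower_series z k : separable_tower U z k.+1 -> transcendental U z 0 ->
  U (fun x => exists e : nat -> pser K,
    [/\ e 0%N = pser_const (z 0%N x) + pserX K,
        forall j, (j <= k)%N -> pcoef (e j) 0 = z j x,
        forall i, (0 < i <= k)%N -> etale_over e i (e i)
      & forall f : itpoly K k.+1, generically0 U z f -> at_series e k.+1 f = 0]).
Proof.
move=> tz tr0; elim: k tz => [_|k IH tz].
  have UT : U (fun=> True).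
    case: (U_or (fun=> True)) => // UF; case: U_nonempty.
    by apply: (U_mono _ UF) => x; apply.
  apply: (U_mono _ UT) => x _; exists (fun=> pser_const (z 0%N x) + pserX K); split=> //.
  - by move=> [|j] // _; rewrite pcoefD /= addr0.
  - by case=> [|i] //; rewrite leqn0 andbF.
  move=> f /tr0 f0; rewrite (_ : f = 0) ?rmorph0 //; apply/polyP => c.
  rewrite coef0; apply: contrapT => nz; apply: U_nonempty.
  by apply: (U_mono _ (f0 c)) => y /nz.
have IHz : separable_tower U z k.+1 by move=> i lt_i; apply: tz; apply: leqW.
have {IH IHz}IHU := IH IHz.
have extend (x : I) (e : nat -> pser K) y :
    e 0%N = pser_const (z 0%N x) + pserX K ->
    (forall j, (j <= k)%N -> pcoef (e j) 0 = z j x) ->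
    (forall i, (0 < i <= k)%N -> etale_over e i (e i)) ->
    pcoef y 0 = z k.+1 x -> etale_over e k.+1 y ->
    (forall f : {poly itpoly K k.+1}, @generically0 _ _ U z k.+2 f ->
      (map_poly (at_series e k.+1) f).[y] = 0) ->
  exists e : nat -> pser K,
    [/\ e 0%N = pser_const (z 0%N x) + pserX K,
        forall j, (j <= k.+1)%N -> pcoef (e j) 0 = z j x,
        forall i, (0 < i <= k.+1)%N -> etale_over e i (e i)
      & forall f : itpoly K k.+2, generically0 U z f -> at_series e k.+2 f = 0].
  move=> e_0 ej ei yz ye yf; pose e' j := if j == k.+1 then y else e j.
  have e'_lt j : (j < k.+1)%N -> e' j = e j by rewrite /e' => /ltn_eqF ->.
  have e'E i : (i <= k.+1)%N -> at_series e' i =1 at_series e i.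
    by move=> le_i f; apply: eq_ieval => j lt_j; apply: e'_lt; apply: leq_trans le_i.
  have e'_etale i w : (i <= k.+1)%N -> etale_over e i w -> etale_over e' i w.
    by move=> le_i [h hP]; exists h; rewrite !(eq_map_poly (e'E i le_i)).
  have e'_last : e' k.+1 = y by rewrite /e' eqxx.
  exists e'; split=> [|j|i /andP[i_gt0]|f f0].
  - by rewrite e'_lt.
  - by rewrite leq_eqVlt => /predU1P[->|lt_j]; rewrite ?e'_last // e'_lt // ej.
  - rewrite leq_eqVlt => /predU1P[->|lt_i]; first by rewrite e'_last; apply: e'_etale.
    by rewrite e'_lt //; apply: e'_etale (ltnW lt_i) _; apply: ei; rewrite i_gt0.
  by rewrite ievalS e'_last (eq_map_poly (e'E _ (leqnn _))) yf.
case: (tz k.+1 (ltnSn _)) => [tr|[h [h0 /ngenerically0 dh /ngenerically0 lh hmin]]].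
  apply: (U_mono _ IHU) => x [e [e_0 ej ei ef]].
  (* A relation for a transcendental coordinate has generically zero coefficients, so any series
     satisfies it; a constant is trivially etale. *)
  apply: (extend x e (pser_const (z k.+1 x))) => //.
    by have := etale_over_ieval e (iconst K k.+1 (z k.+1 x)); rewrite ieval_iconst.
  move=> f /tr f0; rewrite (_ : map_poly _ f = 0) ?horner0 //; apply/polyP => c.
  by rewrite coef_map coef0; apply: ef.
apply: (U_mono _ (U_and IHU (U_and h0 (U_and dh lh)))) => x [[e [e_0 ej ei ef]] [hx [dhx lhx]]].
have valE (q : {poly itpoly K k.+1}) w : pcoef w 0 = z k.+1 x ->
    pcoef (map_poly (at_series e k.+1) q).[w] 0 = ieval idfun (fun j => z j x) k.+2 q.
  move=> wz; pose e' j := if j == k.+1 then w else e j.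
  have -> : (map_poly (at_series e k.+1) q).[w] = at_series e' k.+2 q.
    rewrite ievalS /e' eqxx; congr (_.[_]); apply: eq_map_poly => c.
    by apply: eq_ieval => j /ltn_eqF ->.
  rewrite pcoef0_ieval; apply: eq_ieval => j; rewrite /e' ltnS leq_eqVlt.
  by case: eqP => [->|_] //= lt_j; apply: ej.
pose H := map_poly (at_series e k.+1) h.
have [||y yz Hy] := @hensel _ H (z k.+1 x).
- by rewrite valE.
- by rewrite deriv_map valE //; apply/eqP.
apply: (extend x e y) => //.
  by exists h; split=> //; rewrite valE //; apply/eqP.
move=> f f0.
have nz_h : h != 0.
  by apply/eqP => h_0; apply: lhx; rewrite h_0 lead_coef0 rmorph0.
(* The pseudo-remainder is a relation of smaller degree, so its coefficients are generically zero.
   The power of [lead_coef h] in front of f can be cancelled, since the constant term of its series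
   is nonzero at x. *)
have div_f := Pdiv.Idomain.divp_eq f h.
have r0 : @generically0 _ _ U z k.+2 (f %% h).
  apply: (U_mono _ (U_and f0 h0)) => w [fw hw].
  pose V : {rmorphism {poly itpoly K k.+1} -> K} := ieval idfun (fun j => z j w) k.+2.
  have := congr1 V div_f; rewrite -mul_polyC (rmorphD V) !(rmorphM V).
  by rewrite [V f]fw [V h]hw !mulr0 add0r => <-.
have r_series : (map_poly (at_series e k.+1) (f %% h)).[y] = 0.
  rewrite (_ : map_poly _ _ = 0) ?horner0 //; apply/polyP => c.
  rewrite coef_map coef0; apply: ef; apply: hmin r0 c.
  by rewrite Pdiv.Idomain.ltn_modp.
pose A : {rmorphism itpoly K k.+1 -> pser K} := at_series e k.+1.
have := congr1 (fun q => (map_poly A q).[y]) div_f.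
rewrite map_polyZ hornerZ rmorphD rmorphM hornerD hornerM.
rewrite [(map_poly A (f %% h)).[y]]r_series [(map_poly A h).[y]]Hy mulr0 addr0.
move/eqP; rewrite mulf_eq0 => /orP[|/eqP //].
rewrite (rmorphXn A) expf_eq0 => /andP[_ /eqP l0].
case: lhx; have := pcoef0_ieval e (lead_coef h); rewrite l0 => /esym l0'.
rewrite -[RHS]l0'; apply: eq_ieval => j lt_j; by rewrite ej.
Qed.

End TowerSeries.

(** * Two specializations on one curve *)

Section DoubleCurve.
Variables (K : fieldType) (Kample : ample K) (m : nat) (e : nat -> pser K) (s0 b : K).
Hypotheses (e0 : e 0%N = pser_const s0 + pserX K).
Hypothesis e_etale : forall i, (0 < i <= m)%N -> etale_over e i (e i).
Local Notation at_series e k := (ieval (@pser_const K) e k).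
Variable G : itpoly K m.+1.
Hypothesis G_neq0 : pcoef (at_series e m.+1 G) 0 != 0.

Lemma ample_double_point : exists t (c1 c2 : nat -> K),
  [/\ t != 0, c1 0%N = s0 + t, c2 0%N = s0 + b * t
    & (ieval idfun c1 m.+1 G != 0 /\ ieval idfun c2 m.+1 G != 0) /\
      forall f : itpoly K m.+1, at_series e m.+1 f = 0 ->
        ieval idfun c1 m.+1 f = 0 /\ ieval idfun c2 m.+1 f = 0].
Proof.
have [w w_etale Gw] := etale_over_inv G_neq0.
pose N := m.+2; pose u j := if j == m.+1 then w else e j.
have u_lt j : (j < m.+1)%N -> u j = e j by rewrite /u => /ltn_eqF ->.
have uE i : (i <= m.+1)%N -> at_series u i =1 at_series e i.
  by move=> le_i f; apply: eq_ieval => j lt_j; apply: u_lt; apply: leq_trans le_i.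
have u_w : u m.+1 = w by rewrite /u eqxx.
have u_etale i : (0 < i < N)%N -> etale_over u i (u i).
  case/andP=> i_gt0; rewrite ltnS => le_i.
  suff [h hP] : etale_over e i (u i) by exists h; rewrite !(eq_map_poly (uE i le_i)).
  move: le_i; rewrite leq_eqVlt => /predU1P[->|lt_i]; first by rewrite u_w.
  by rewrite u_lt //; apply: e_etale; rewrite i_gt0.
pose S := pser_subst b.
(* Coordinate 0 is t itself, followed by the N series of u and by the same series at b t; hence the
   shifts by 1 and N + 1. *)
pose d i := if i is i'.+1 then if (i' < N)%N then u i' else S (u (i' - N)%N) else pserX K.
have dL j : (j < N)%N -> d j.+1 = u j by move=> lt_j; rewrite /d lt_j.
have dR j : d (N + j).+1 = S (u j) by rewrite /d ltnNge leq_addr addKn.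
have u0 : u 0%N = pser_const s0 + pserX K by rewrite u_lt.
have d_etale i : (0 < i <= N + N)%N -> etale_over d i (d i).
  case: i => [//|i] /=; rewrite /= -/(d i.+1); have [lt_i|le_Ni] := ltnP i N => le_i.
    rewrite dL //; have [->|i_gt0] := posnP i.
      (* The first series s0 + t has no etale equation of its own, but is now a polynomial in
         coordinate 0. *)
      have := etale_over_ieval d (iaffine 1 s0 1 0).
      by rewrite ieval_iaffine // rmorph1 mul1r u0.
    apply: (etale_over_rmorph (e := u) (i := i) (S := idfun)) => // [j lt_j|].
      by exists (ivar K i.+1 j.+1); rewrite ieval_ivar // dL // (ltn_trans lt_j).
    by apply: u_etale; rewrite i_gt0.
  rewrite -(subnKC le_Ni); set l := (i - N)%N.
  have lt_l : (l < N)%N by rewrite /l ltn_subLR.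
  rewrite dR; have [->|l_gt0] := posnP l.
    have := etale_over_ieval d (iaffine (N + 0).+1 s0 b 0).
    rewrite ieval_iaffine // u0.
    by rewrite /S rmorphD /= pser_subst_const pser_substX.
  apply: (etale_over_rmorph (e := u) (i := l) (S := S)) => [c|f|j lt_j|].
  - exact: pser_subst_const.
  - by rewrite /= mul1r.
  - by exists (ivar K (N + l).+1 (N + j).+1); rewrite ieval_ivar ?dR // ltnS ltn_add2l.
  by apply: u_etale; rewrite l_gt0.
pose h i : {poly itpoly K i} :=
  if pselect (0 < i <= N + N)%N is left hi then projT1 (cid (d_etale i hi)) else 0.
have hP i : (0 < i <= N + N)%N -> at_series d i.+1 (h i) = 0 /\
    pcoef (at_series d i.+1 (h i)^`()) 0 != 0.
  by rewrite /h => hi; case: pselect => // hi'; case: (cid _).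
have [a [nz_a0 aP]] := @ample_tower_point K (N + N) d h erefl
  (fun i hi => (hP i hi).1) (fun i hi => (hP i hi).2) Kample.
have transfer (s : nat -> nat) (T : {rmorphism pser K -> pser K}) (f : itpoly K N) :
    (forall c, T (pser_const c) = pser_const c) ->
    (forall j, (j < N)%N -> (s j < (N + N).+1)%N /\ d (s j) = T (u j)) ->
    at_series u N f = 0 -> ieval idfun (a \o s) N f = 0.
  move=> TC sP f0; pose g := ieval (iconst K (N + N).+1) (fun j => ivar K (N + N).+1 (s j)) N f.
  have gd : at_series d (N + N).+1 g = T (at_series u N f).
    rewrite /g (rmorph_ieval (kappa := @pser_const K)) => [|c]; last exact: ieval_iconst.
    rewrite (rmorph_ieval (phi := T) (kappa := @pser_const K)) => [|c]; last exact: TC.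
    apply: eq_ieval => j /sP[lt_s dE]; rewrite -[RHS]dE; exact: ieval_ivar.
  have := aP g; rewrite gd f0 rmorph0 => /(_ erefl) <-.
  rewrite /g (rmorph_ieval (kappa := idfun)) => [|c]; last exact: ieval_iconst.
  by apply: eq_ieval => j /sP[lt_s _]; apply/esym/ieval_ivar.
have transferL f : at_series u N f = 0 -> ieval idfun (fun j => a j.+1) N f = 0.
  apply: (transfer succn idfun) => // j lt_j; split; last exact: dL.
  by rewrite ltnS; apply: leq_trans lt_j (leq_addr _ _).
have transferR f : at_series u N f = 0 -> ieval idfun (fun j => a (N + j).+1) N f = 0.
  apply: (transfer (fun j => (N + j).+1) S) => [c|j lt_j].
    exact: pser_subst_const.
  by split; [rewrite ltnS ltn_add2l | apply: dR].
have affine j c x : (j < (N + N).+1)%N -> d j = pser_const c + pser_const x * pserX K ->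
    a j = c + x * a 0%N.
  move=> lt_j dj; have := aP (ivar K _ j - iaffine _ c x 0).
  rewrite rmorphB ieval_ivar // ieval_iaffine // dj subrr => /(_ erefl) /eqP.
  by rewrite rmorphB ieval_ivar // ieval_iaffine // subr_eq0 => /eqP.
have c10 : a 1%N = s0 + a 0%N.
  by rewrite (affine 1%N s0 1) ?mul1r // dL // u0 rmorph1 mul1r.
have c20 : a (N + 0).+1 = s0 + b * a 0%N.
  by apply: affine; rewrite ?ltnS ?ltn_add2l // dR u0 /S rmorphD /= pser_subst_const pser_substX.
have nzG (c : nat -> K) : (forall f, at_series u N f = 0 -> ieval idfun c N f = 0) ->
    ieval idfun c m.+1 G != 0.
  move=> cP; have := cP (G%:P * 'X - 1).
  rewrite !rmorphB !rmorph1 !ievalMX !ieval_const uE // u_w Gw subrr => /(_ erefl) /eqP.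
  rewrite subr_eq0 => /eqP Gc.
  by apply: contra_eqN Gc => /eqP ->; rewrite mul0r eq_sym oner_eq0.
exists (a 0%N), (fun j => a j.+1), (fun j => a (N + j).+1); split=> //; split.
  by split; apply: nzG.
move=> f f0; split.
  by rewrite -(ieval_const idfun (fun j => a j.+1)); apply: transferL; rewrite ieval_const uE.
by rewrite -(ieval_const idfun (fun j => a (N + j).+1)); apply: transferR; rewrite ieval_const uE.
Qed.

End DoubleCurve.

(** * Definability *)

(** The ultrafilter extends the filter of the sets that contain all but finitely many elements of X,
    which is proper because X is infinite. *)
Lemma infinite_ultrafilter (T : eqType) (X : T -> Prop) : infinite_subset X ->
  exists U : (T -> Prop) -> Prop,
  [/\ forall A B : T -> Prop, (forall x, A x -> B x) -> U A -> U B,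
      forall A B : T -> Prop, U A -> U B -> U (fun x => A x /\ B x),
      forall A : T -> Prop, U A \/ U (fun x => ~ A x),
      ~ U (fun=> False)
    & U X /\ forall s : seq T, U (fun x => x \notin s)].
Proof.
move=> Xinf.
pose F (A : T -> Prop) := exists s : seq T, forall x, X x -> x \notin s -> A x.
have FF : filter.ProperFilter F.
  split; first by move=> [s Fs]; have [x Xx] := Xinf s; apply: Fs.
  split; first by exists [::].
    move=> A B [s As] [t Bt]; exists (s ++ t) => x Xx.
    by rewrite mem_cat negb_or => /andP[/As As' /Bt Bt']; split; [apply: As' | apply: Bt'].
  by move=> A B AB [s As]; exists s => x Xx xs; apply/AB/As.
have [U [UU FU]] := filter.ultraFilterLemma FF.
have UP := @filter.ultra_proper _ _ UU; have UF := @filter.filter_filter _ _ UP.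
exists U; split.
- by move=> A B AB; apply: filter.filterS.
- by move=> A B; apply: filter.filterI.
- by move=> A; apply: filter.in_ultra_setVsetC.
- exact: filter.filter_not_empty.
split; first by apply: FU; exists [::].
by move=> s; apply: FU; exists s.
Qed.

Section Definability.
Variable K : fieldType.
Implicit Types (f g : GRing.formula K) (t : GRing.term K).

(** Only the list B of quantified indices is recorded: the order of the quantifiers and repeated
    indices do not affect the condition that some environment agreeing off B satisfies the
    matrix. *)
Lemma prenex_holds f : prenex_existential f -> GRing.rformula f ->
  exists (B : seq nat) g, [/\ GRing.qf_form g, GRing.rformula g
    & forall e, GRing.holds e f <->
        exists2 e', forall i, i \notin B -> e'`_i = e`_i & GRing.holds e' g].
Proof.
have qf f' : GRing.qf_form f' -> GRing.rformula f' ->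
    exists (B : seq nat) g, [/\ GRing.qf_form g, GRing.rformula g
    & forall e, GRing.holds e f' <->
        exists2 e', forall i, i \notin B -> e'`_i = e`_i & GRing.holds e' g].
  move=> qf_f r_f; exists [::], f'; split=> // e; split=> [|[e' eq_e]]; first by exists e.
  by apply: GRing.eq_holds => i; apply: eq_e.
elim: f; try by move=> *; apply: qf.
move=> i f IH /= pf rf; have [B [g [qg rg gP]]] := IH pf rf.
exists (i :: B), g; split=> // e; split.
  move=> [x /gP[e' eq_e e'g]]; exists e' => // j.
  by rewrite inE negb_or => /andP[/negPf ne_j /eq_e ->]; rewrite nth_set_nth /= ne_j.
move=> [e' eq_e e'g]; exists e'`_i; apply/gP; exists e' => // j nBj.
rewrite nth_set_nth /=; case: eqP => [->//|/eqP ne_j].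
by apply: eq_e; rewrite inE negb_or ne_j.
Qed.

Variables (M : nat) (q : nat -> nat).

(* Extracting p-th roots to get a separable tower turned the j-th coordinate of
   the original system into the q_j-th power of the j-th tower coordinate. *)
Definition power_env (c : nat -> K) := mkseq (fun j => c j ^+ q j) M.

(** Variables from M on are read as 0, in accordance with the default value of [nth]; the value at
    [GRing.Inv] is arbitrary, as [GRing.rterm] excludes that symbol. *)
Fixpoint term_itpoly t : itpoly K M :=
  match t with
  | GRing.Var i => if (i < M)%N then ivar K M i ^+ q i else 0
  | GRing.Const c => iconst K M c
  | GRing.NatConst n => n%:R
  | GRing.Add t1 t2 => term_itpoly t1 + term_itpoly t2
  | GRing.Opp t1 => - term_itpoly t1
  | GRing.NatMul t1 n => term_itpoly t1 *+ n
  | GRing.Mul t1 t2 => term_itpoly t1 * term_itpoly t2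
  | GRing.Inv t1 => 0
  | GRing.Exp t1 n => term_itpoly t1 ^+ n
  end.

Lemma ieval_term_itpoly c t : GRing.rterm t ->
  ieval idfun c M (term_itpoly t) = GRing.eval (power_env c) t.
Proof.
elim: t => //=.
- move=> i _; case: ltnP => [lt_i|le_i]; last first.
    by rewrite rmorph0 nth_default // size_mkseq.
  by rewrite rmorphXn ieval_ivar // nth_mkseq.
- by move=> x _; rewrite ieval_iconst.
- by move=> n _; rewrite rmorph_nat.
- by move=> t1 IH1 t2 IH2 /andP[/IH1 <- /IH2 <-]; rewrite rmorphD.
- by move=> t IH /IH <-; rewrite rmorphN.
- by move=> t IH n /IH <-; rewrite rmorphMn.
- by move=> t1 IH1 t2 IH2 /andP[/IH1 <- /IH2 <-]; rewrite rmorphM.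
by move=> t IH n /IH <-; rewrite rmorphXn.
Qed.

Variables (I : Type) (U : (I -> Prop) -> Prop).
Hypothesis U_mono : forall A B : I -> Prop, (forall x, A x -> B x) -> U A -> U B.
Hypothesis U_and : forall A B : I -> Prop, U A -> U B -> U (fun x => A x /\ B x).
Hypothesis U_or : forall A : I -> Prop, U A \/ U (fun x => ~ A x).
Variable z : nat -> I -> K.

Definition specialization (c : nat -> K) :=
  forall f : itpoly K M, generically0 U z f -> ieval idfun c M f = 0.

(** An equation that holds generically passes to every specialization; one that fails generically
    contributes its polynomial as a factor of G, so that it fails wherever G is nonzero. *)
Lemma qf_holds_specialization g : GRing.qf_form g -> GRing.rformula g ->
  exists G : itpoly K M, U (fun x => ieval idfun (fun j => z j x) M G <> 0 /\
    forall c, specialization c -> ieval idfun c M G <> 0 ->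
      (GRing.holds (power_env c) g <-> GRing.holds (power_env (fun j => z j x)) g)).
Proof.
have UT A : (forall x, A x) -> U A.
  move=> allA; case: (U_or A) => //; apply: U_mono => x _; exact: allA.
pose stable g' := exists G : itpoly K M,
  U (fun x => ieval idfun (fun j => z j x) M G <> 0 /\
    forall c, specialization c -> ieval idfun c M G <> 0 ->
      (GRing.holds (power_env c) g' <-> GRing.holds (power_env (fun j => z j x)) g')).
have stable2 (g1 g2 g' : GRing.formula K) :
    (forall e e', (GRing.holds e g1 <-> GRing.holds e' g1) ->
      (GRing.holds e g2 <-> GRing.holds e' g2) ->
      (GRing.holds e g' <-> GRing.holds e' g')) ->
    stable g1 -> stable g2 -> stable g'.
  move=> compat [G1 U1] [G2 U2]; exists (G1 * G2).
  apply: (U_mono _ (U_and U1 U2)) => x [[G1x P1] [G2x P2]]; split=> [|c cs].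
    by rewrite rmorphM => /eqP; rewrite mulf_eq0 => /orP[] /eqP.
  rewrite rmorphM => Gc; apply: compat; [apply: P1 | apply: P2] => //;
  by move=> G0; apply: Gc; rewrite G0 ?mul0r ?mulr0.
rewrite -/(stable g); elim: g => //=.
- move=> b _ _; exists 1; apply: UT => x; split=> //.
  by rewrite rmorph1; apply/eqP; rewrite oner_eq0.
- move=> t1 t2 _ /andP[r1 r2]; pose P := term_itpoly t1 - term_itpoly t2.
  have PE c : ieval idfun c M P = GRing.eval (power_env c) t1 - GRing.eval (power_env c) t2.
    by rewrite rmorphB /= !ieval_term_itpoly.
  case: (U_or (fun x => ieval idfun (fun j => z j x) M P = 0)) => UP.
    exists 1; apply: (U_mono _ UP) => x; rewrite PE => /eqP; rewrite subr_eq0 => /eqP Px.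
    split=> [|c cs _]; first by rewrite rmorph1; apply/eqP; rewrite oner_eq0.
    split=> // _; apply/eqP; rewrite -subr_eq0 -PE; apply/eqP; exact: cs.
  exists P; apply: (U_mono _ UP) => x Px; split=> // c _ Pc.
  by split=> eq12; [case: Pc | case: Px]; rewrite PE eq12 subrr.
- move=> g1 IH1 g2 IH2 /andP[q1 q2] /andP[r1 r2].
  by apply: (stable2 g1 g2); [move=> e e' /= [? ?] [? ?]; tauto | apply: IH1 | apply: IH2].
- move=> g1 IH1 g2 IH2 /andP[q1 q2] /andP[r1 r2].
  by apply: (stable2 g1 g2); [move=> e e' /= [? ?] [? ?]; tauto | apply: IH1 | apply: IH2].
- move=> g1 IH1 g2 IH2 /andP[q1 q2] /andP[r1 r2].
  by apply: (stable2 g1 g2); [move=> e e' /= [? ?] [? ?]; tauto | apply: IH1 | apply: IH2].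
move=> g1 IH1 q1 r1.
by apply: (stable2 g1 g1); [move=> e e' /= [? ?] _; tauto | apply: IH1 | apply: IH1].
Qed.

End Definability.

Theorem corollary8 (K : fieldType) (HKperfect : perfect_field K)
    (HKample : ample K) (L : K -> Prop) (HLsub : subfield L)
    (HLinf : infinite_subset L) (HLdef : existentially_definable L) :
  forall x : K, L x.
Proof.
move=> a; have [f /andP[rf pf] fP] := HLdef; have [L1 LB Ldiv] := HLsub.
have [B [g [qg rg gP]]] := prenex_holds pf rf.
(* If index 0 is itself quantified, the condition does not depend on x, and [L 1] gives every
   element. *)
have [B0|nB0] := boolP (0%N \in B).
  have /fP/gP[e' eq_e e'g] := L1; apply/fP/gP; exists e' => // i nBi.
  rewrite eq_e //; case: i nBi => [|i _]; first by rewrite B0.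
  by rewrite !nth_default.
have /choice[w wP] : forall x, exists e' : seq K, L x ->
    (forall i, i \notin B -> e'`_i = [:: x]`_i) /\ GRing.holds e' g.
  move=> x; have [/fP/gP[e' eq_e e'g]|nLx] := pselect (L x); last by exists [::].
  by exists e'.
(* Indices above m are not quantified, so their value is 0, and m + 1 coordinates suffice. *)
pose m := \max_(i <- B) i; pose v j (x : K) := (w x)`_j.
have v0 x : L x -> v 0%N x = x by move=> /wP[/(_ _ nB0)].
have vB i x : L x -> i \notin B -> (0 < i)%N -> v i x = 0.
  by move=> /wP[eq_e _] /eq_e vi; case: i vi => // i; rewrite /v => -> _; rewrite nth_default.
have leB i : i \in B -> (i <= m)%N by move=> iB; apply: leq_bigmax_seq.
have [U [U_mono U_and U_or U_nonempty [UL U_cofinite]]] := infinite_ultrafilter HLinf.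
have [p [r [phi [phiE rK phiK charK]]]] := perfect_frobenius HKperfect.
have [z [k [tz zv]]] :=
  separable_tower_exists U_mono U_and phiE rK phiK charK v m.+1.
pose q j := (p ^ k j)%N.
have phi_iter l (x : K) : x ^+ (p ^ l) = iter l phi x.
  by elim: l => [|l IH]; rewrite ?expn0 ?expr1 // expnSr exprM IH iterS phiE.
(* A nonzero polynomial over K has finitely many roots z_0(x), hence accounts for finitely many x =
   z_0(x)^q in L; the ultrafilter avoids finite sets. *)
have tr0 : transcendental U z 0.
  move=> P P0 c; suff -> : P = 0 by rewrite coef0; apply: U_mono UL => x _; rewrite rmorph0.
  apply: contrapT => /eqP/(@root_list K)[s sP]; apply: U_nonempty.
  apply: U_mono (U_and _ _ (U_and _ _ P0 UL) (U_cofinite [seq y ^+ q 0%N | y <- s])).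
  move=> x [[Px Lx]]; apply/negP; rewrite negbK; apply/mapP; exists (z 0%N x).
    by apply/sP/eqP; rewrite -[RHS]Px ievalS map_poly_id.
  by rewrite -[LHS](v0 x Lx) zv.
have Useries := tower_series U_mono U_and U_or U_nonempty tz tr0.
have [G UG] := qf_holds_specialization m.+1 q U_mono U_and U_or z qg rg.
have [x [[e [e_0 e_pcoef e_etale e_rel]] [Lx [Gx gx]]]] : exists x,
  (exists e : nat -> pser K,
    [/\ e 0%N = pser_const (z 0%N x) + pserX K,
        forall j, (j <= m)%N -> pcoef (e j) 0 = z j x,
        forall i, (0 < i <= m)%N -> etale_over e i (e i)
      & forall f : itpoly K m.+1, generically0 U z f ->
          ieval (@pser_const K) e m.+1 f = 0]) /\
  L x /\ (ieval idfun (fun j => z j x) m.+1 G <> 0 /\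
    forall c, specialization m.+1 U z c -> ieval idfun c m.+1 G <> 0 ->
      (GRing.holds (power_env m.+1 q c) g <->
       GRing.holds (power_env m.+1 q (fun j => z j x)) g)).
  apply: contrapT => none; apply: U_nonempty.
  apply: U_mono (U_and _ _ Useries (U_and _ _ UL UG)) => y Py.
  by apply: none; exists y.
have env_eq y c : (forall i, (i < m.+1)%N -> c i ^+ q i = v i y) -> L y ->
    GRing.same_env (power_env m.+1 q c) (w y).
  move=> cE Ly i; have [lt_i|le_i] := ltnP i m.+1; first by rewrite nth_mkseq // cE.
  rewrite nth_default ?size_mkseq //; apply/esym/vB => //; last exact: leq_trans le_i.
  by apply/negP => /leB; rewrite leqNgt le_i.
have gz : GRing.holds (power_env m.+1 q (fun j => z j x)) g.
  have [_ wg] := wP x Lx; apply: GRing.eq_holds wg; apply: GRing.same_env_sym.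
  by apply: env_eq => // i lt_i; rewrite -zv.
pose b := iter (k 0%N) r a.
have bE : b ^+ q 0%N = a by apply: iter_frobenius.
have G0 : pcoef (ieval (@pser_const K) e m.+1 G) 0 != 0.
  rewrite pcoef0_ieval; apply/eqP => Gx0; apply: Gx; rewrite -[RHS]Gx0.
  by apply: eq_ieval => j lt_j; rewrite e_pcoef.
have [t [c1 [c2 [nz_t c10 c20 [[Gc1 Gc2] c12]]]]] :=
  ample_double_point HKample b e_0 e_etale G0.
(* At an unquantified index i > 0 the generic value is 0, so [X_i^(q i)] is a generic relation and c
   satisfies it. The environment of c thus agrees off B with the one that lists only its entry 0. *)
have L_point c : specialization m.+1 U z c -> ieval idfun c m.+1 G != 0 -> L (c 0%N ^+ q 0%N).
  move=> cs /eqP Gc; apply/fP/gP; exists (power_env m.+1 q c); last exact/gx.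
  move=> i nBi; have [lt_i|le_i] := ltnP i m.+1; last first.
    rewrite nth_default ?size_mkseq //; case: i le_i {nBi} => // i _.
    by rewrite nth_default.
  rewrite nth_mkseq //; case: i nBi lt_i => [//|i] nBi lt_i; rewrite [RHS]nth_default //.
  have := cs (ivar K m.+1 i.+1 ^+ q i.+1); rewrite rmorphXn ieval_ivar //; apply.
  apply: U_mono UL => y Ly; rewrite rmorphXn ieval_ivar //.
  by rewrite -zv // vB.
have Ly1 := L_point c1 (fun f hf => (c12 f (e_rel f hf)).1) Gc1.
have Ly2 := L_point c2 (fun f hf => (c12 f (e_rel f hf)).2) Gc2.
(* The q-th power map is an iterate of the ring morphism phi, in either characteristic. *)
have frobD (y1 y2 : K) : (y1 + y2) ^+ q 0%N = y1 ^+ q 0%N + y2 ^+ q 0%N.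
  rewrite /q !phi_iter.
  by elim: (k 0%N) => [//|l IH]; rewrite !iterS IH rmorphD.
have xE : z 0%N x ^+ q 0%N = x by rewrite -zv // v0.
have := Ldiv _ _ (LB _ _ Ly2 Lx) (LB _ _ Ly1 Lx).
rewrite c10 c20 !frobD xE ![x + _]addrC !addrK exprMn bE mulfK //.
exact: expf_neq0.
Qed.
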